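(* Let $G$ be an infinite graph, let $k \in \mathbb{N}$ and let $\kappa \leq |V(G)|$ be an infinite cardinal. Then the following statements are equivalent. (a) $V(G)$ contains a subset of size $\kappa$ that is $k$-connected in $G$. (b) The $k$-tree-width of $G$ is greater than $\kappa$.
   Context: Graphs are simple and undirected, possibly infinite. Paths are finite; a single vertex is a trivial path. For $k\in\mathbb{N}$, a set $X$ of at least $k$ vertices of $G$ is $k$-connected in $G$ if for all $Z_1,Z_2\subseteq X$ with $|Z_1|=|Z_2|\le k$ there are $|Z_1|$ many vertex-disjoint paths from $Z_1$ to $Z_2$ in $G$ ($Z_1$ and $Z_2$ need not be disjoint; a vertex in $Z_1\cap Z_2$ counts as a trivial path). A tree-decomposition of $G$ is a pair $(T,(V_t)_{t\in V(T)})$ with $T$ a (possibly infinite) tree and $V_t\subseteq V(G)$ (the parts) such that $V(G)=\bigcup_t V_t$, every edge of $G$ has both endvertices in some $V_t$, and $V_{t_1}\cap V_{t_3}\subseteq V_{t_2}$ whenever $t_2$ lies on the path in $T$ between $t_1$ and $t_3$. It has adhesion less than $k$ if $|V_{t}\cap V_{t'}|<k$ for every edge $tt'$ of $T$. The $k$-tree-width of $G$ is the smallest cardinal $\lambda$ such that there is a tree-decomposition of $G$ of adhesion less than $k$ in which each part has size less than $\lambda$. *)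

(* Defs.v *)
From mathcomp Require Import all_boot.
From mathcomp Require Import boolp classical_sets functions cardinality.

Set Implicit Arguments.
Unset Strict Implicit.
Unset Printing Implicit Defensive.

Local Open Scope classical_set_scope.
Local Open Scope card_scope.

(* Cardinals are represented by sets or types up to equipotence [#=], so that
   [#<=] is the order on cardinals and [card_lt] its strict part. *)
Definition card_lt (T U : Type) (A : set T) (B : set U) : bool :=
  (A #<= B) && (A #!= B).

(* A simple undirected graph, possibly infinite.  Asking for a choiceType and
   a boolean adjacency is no restriction: classically, every type T carries
   such a structure ({classic T}) and every relation is boolean. *)
Record sgraph := SGraph {
  vertex :> choiceType;
  adj : rel vertex;
  adj_sym : symmetric adj;
  adj_irr : irreflexive adj }.

(* [s] is the sequence of all vertices of the path, in order. *)
Definition is_path (G : sgraph) (x y : G) (s : seq G) : Prop :=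
  exists p : seq G,
    [/\ s = x :: p, path (@adj G) x p, uniq s & last x p = y].

(* Paths in [P] are nonempty sequences, so two distinct members of [P] that
   share no vertex are distinct as paths of [G], whatever their orientation;
   hence [P] contains exactly |Z1| disjoint paths. *)
Definition linked (G : sgraph) (Z1 Z2 : set G) : Prop :=
  exists P : set (seq G),
    [/\ P #= Z1,
        forall s, P s -> exists x y, [/\ Z1 x, Z2 y & is_path x y s] &
        forall s t, P s -> P t -> s <> t ->
          forall v : G, ~ (v \in s /\ v \in t)].

Definition k_connected (G : sgraph) (k : nat) (X : set G) : Prop :=
  `I_k #<= X /\
  forall Z1 Z2 : set G, Z1 `<=` X -> Z2 `<=` X ->
    Z1 #= Z2 -> Z1 #<= `I_k -> linked Z1 Z2.

Definition connected_graph (G : sgraph) : Prop :=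
  inhabited G /\ forall x y : G, exists s, is_path x y s.

(* [ucycle] counts the empty sequence, and the two ends of a single edge, as
   cyclic sequences; these are not cycles of a simple graph. *)
Definition acyclic (G : sgraph) : Prop :=
  forall c : seq G, ucycle (@adj G) c -> size c <= 2.

Definition is_tree (T : sgraph) : Prop := connected_graph T /\ acyclic T.

Definition tree_decomposition (G T : sgraph) (part : T -> set G) : Prop :=
  [/\ is_tree T,
      forall v : G, exists t, part t v,
      forall u v : G, adj u v -> exists t, part t u /\ part t v &
      forall (t1 t2 t3 : T) (s : seq T), is_path t1 t3 s -> t2 \in s ->
        part t1 `&` part t3 `<=` part t2].

Definition adhesion_lt (G T : sgraph) (part : T -> set G) (k : nat) : Prop :=
  forall t t' : T, adj t t' -> card_lt (part t `&` part t') `I_k.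

Definition has_decomposition (G : sgraph) (k : nat) (L : Type) : Prop :=
  exists (T : sgraph) (part : T -> set G),
    [/\ tree_decomposition part, adhesion_lt part k &
        forall t, card_lt (part t) [set: L]].

(* The k-tree-width of G is the cardinality of L. *)
Definition is_k_tree_width (G : sgraph) (k : nat) (L : Type) : Prop :=
  has_decomposition G k L /\
  forall L' : Type, has_decomposition G k L' -> [set: L] #<= [set: L'].

(* Main.v *)
Require Import Defs.
From mathcomp Require Import all_boot.
From mathcomp Require Import boolp classical_sets functions cardinality.

(* Separations are encoded by a set [B] of vertices and its boundary [bd S B], a submodular
   function of [B]; the vertices of [S] are forced into the boundary.

   A k-connected set of size K orients the edges of a tree-decomposition of adhesion < k towards
   the side containing almost all of it. A ray in this orientation would exhaust the k-connected
   set by finite pieces. A sink has a small part, over which the rest of the set is distributed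
   in finite fibres indexed by small subsets of the part.

   Conversely, suppose that there is no k-connected set of size K. A maximal set Y all of whose
   small subsets are linked to a given finite set S contains a k-connected set of the same size
   if it is infinite, so Y is small, and every other vertex is cut off from S by a separation of
   order < k that is tight for some Z in Y with |Z| < k. Uncrossing these separations (finitely
   many if K is countable; otherwise after closing Y, using separations closest to hubs, that
   is, to k-sets which no separation of order < k splits) yields a small bag containing S all of
   whose complementary components have fewer than k neighbours. Iterating this along the
   components gives a tree-decomposition indexed by finite sequences. *)

Set Implicit Arguments.
Unset Strict Implicit.
Unset Printing Implicit Defensive.
Local Open Scope classical_set_scope.
Local Open Scope card_scope.

(** * Comparison of cardinals *)

(** [K] may be singular, so a small union of small sets can fail to be small. Counting therefore
    goes through finite sets indexed by bounded finite sequences from one small set, which is sound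
    for every infinite [K]. For the same reason a vertex outside Y is placed in the largest set
    tight for Z: it depends on Z alone, so a small Y yields few separations.

    The set S is the neighbourhood (fewer than k vertices) of the region still to be decomposed,
    together with one vertex of that region.

    The two cases for K answer two obstacles. Pairwise uncrossing loses finitely many vertices at
    each step, so it only handles finitely many separations, while closing Y may make it countably
    infinite, which is not small for countable K. Nearest separations of hubs are nested or cross
    harmlessly from the start, so there is nothing to uncross.

    Separations take the place of disjoint paths until the very end, where Menger's theorem turns
    inseparability into k-connectedness. *)

Lemma card_le_relP T U (A : set T) (B : set U) :
  A #<= B <-> exists R : T -> U -> Prop,
    (forall x, A x -> exists2 y, B y & R x y) /\
    (forall x x' y, A x -> A x' -> R x y -> R x' y -> x = x').
Proof.
split=> [/card_leP[f]|[R [Rtot Rinj]]].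
  exists (fun x y => exists Ax : A x, y = val (f (SigSub (mem_set Ax)))).
  split=> [x Ax|x x' y Ax Ax' [px ->] [px' e]].
    by exists (val (f (SigSub (mem_set Ax)))); [apply: set_valP|exists Ax].
  by have /(congr1 val) := 'inj_f (in_setT _) (in_setT _) (val_inj e).
have /choice[g gP] (x : A) : exists y : B, R (val x) (val y).
  have [y By Rxy] := Rtot _ (set_valP x).
  by exists (SigSub (mem_set By)).
apply/card_leP/injfunPex; exists g => // x y _ _ e.
apply: val_inj; apply: (Rinj _ _ (val (g x)) (set_valP x) (set_valP y) (gP x)).
by rewrite e; exact: gP.
Qed.

Lemma card_le_fun T U (A : set T) (B : set U) (f : T -> U) :
  (forall x, A x -> B (f x)) ->
  (forall x y, A x -> A y -> f x = f y -> x = y) -> A #<= B.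
Proof.
move=> fAB finj; apply/card_le_relP; exists (fun x y => y = f x); split.
  by move=> x Ax; exists (f x) => //; exact: fAB.
by move=> x x' y Ax Ax' -> /finj; exact.
Qed.

Lemma card_le_surj T U (A : set T) (B : set U) (R : T -> U -> Prop) :
  (forall y, B y -> exists2 x, A x & R x y) ->
  (forall x y y', R x y -> R x y' -> y = y') -> B #<= A.
Proof.
move=> Rsurj Rfun; apply/card_le_relP; exists (fun y x => R x y); split=> //.
by move=> y y' x _ _; exact: Rfun.
Qed.

(** The usual form of Zorn's lemma is applied to the sets whose union with [A0] satisfies [P]; the
    empty chain then asks only for [P A0]. *)
Lemma Zorn_above T (P : set (set T)) (A0 : set T) :
  P A0 ->
  (forall F : set (set T), F `<=` P -> F !=set0 -> total_on F subset ->
    P (\bigcup_(X in F) X)) ->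
  exists2 M, P M & A0 `<=` M /\ forall B, M `<=` B -> P B -> B `<=` M.
Proof.
move=> PA0 Pchain.
have [F FP Ftot|M [PM Mmax]] := @Zorn_bigcup T [set X | P (A0 `|` X)].
  have [[X0 FX0]|F0] := pselect (F !=set0); last first.
    rewrite /= (_ : _ `|` _ = A0)//; apply/seteqP; split=> x; last by left.
    by case=> // -[X FX]; case: F0; exists X.
  pose F' := [set A0 `|` X | X in F].
  rewrite /= (_ : _ `|` _ = \bigcup_(X in F') X); last first.
    apply/seteqP; split=> x.
      case=> [A0x|[X FX Xx]].
        by exists (A0 `|` X0); [exists X0|left].
      by exists (A0 `|` X); [exists X|right].
    by case=> _ [X FX <-] [|Xx]; [left|right; exists X].
  apply: Pchain.
  - by move=> _ [X FX <-]; exact: FP.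
  - by exists (A0 `|` X0), X0.
  - move=> _ _ [X FX <-] [Y FY <-].
    by have [XY|YX] := Ftot _ _ FX FY; [left|right]; exact: setUS.
exists (A0 `|` M) => //; split; first exact: subsetUl.
move=> B MB PB; apply: contrapT => BM.
apply: (Mmax B); last first.
  by rewrite /= (_ : _ `|` B = B)//; apply/setUidPr => x A0x; apply: MB; left.
split; first by move=> x Mx; apply: MB; right.
by move=> BM'; apply: BM => x /BM'; right.
Qed.

(* Zorn's lemma on families of choice functions that disagree everywhere: a maximal one
   exhausts some [A i]. *)
Lemma card_min (I W : Type) (A : I -> set W) (i0 : I) :
  exists i, forall j, A i #<= A j.
Proof.
pose P := [set F : set (I -> W) | (forall f i, F f -> A i (f i)) /\
  (forall f g i, F f -> F g -> f i = g i -> f = g)].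
have [||M [MA Minj] [_ Mmax]] := @Zorn_above _ P set0.
- by split.
- move=> F FP _ Ftot; split=> [f i [X FX Xf]|f g i [X FX Xf] [Y FY Yg]].
    by have [+ _] := FP _ FX; exact.
  have [XY|YX] := Ftot _ _ FX FY.
    by have [_] := FP _ FY; apply=> //; exact: XY.
  by have [_] := FP _ FX; apply=> //; exact: YX.
have [[i Mi]|noti] := pselect (exists i, forall w, A i w -> exists2 f, M f & f i = w).
  exists i => j; apply/card_le_relP.
  exists (fun w v => exists2 f, M f & w = f i /\ v = f j); split.
    move=> w /Mi[f Mf fw]; exists (f j); first exact: MA.
    by exists f.
  by move=> w w' v _ _ [f Mf [-> ->]] [g Mg [->]] /Minj ->.
(* Otherwise every [A i] has a value missed by all of [M]. A choice of such values extends [M], so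
   it belongs to [M] and differs from itself at [i0]. *)
have /choice[f fP] i : exists w, A i w /\ forall g, M g -> g i <> w.
  apply: contrapT => nw; apply: noti; exists i => w Aw.
  apply: contrapT => nf; apply: nw; exists w; split=> // g Mg gw.
  by apply: nf; exists g.
suff /Mmax : P (f |` M).
  move=> /(_ (@subsetUr _ _ _))/(_ f (or_introl erefl)) Mf.
  by have [_ /(_ f Mf)] := fP i0.
split=> [g i [->|/MA]//|g h i].
  by have [] := fP i.
case=> [->|Mg] [->|Mh]// e; last exact: Minj e.
  by have [_ /(_ h Mh)] := fP i; rewrite e.
by have [_ /(_ g Mg)] := fP i.
Qed.

(** Of the copies of [A] and [B] in the sum type, one has least cardinality. *)
Lemma card_le_total T U (A : set T) (B : set U) : (A #<= B) \/ (B #<= A).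
Proof.
pose C (b : bool) : set (T + U) := if b then inl @` A else inr @` B.
have CA : C true #= A by apply: inj_card_eq => x y _ _ [].
have CB : C false #= B by apply: inj_card_eq => x y _ _ [].
have [i iP] := card_min C true.
case: i iP => iP; [left|right].
  by rewrite -(card_le_eql CA) -(card_le_eqr CB).
by rewrite -(card_le_eql CB) -(card_le_eqr CA).
Qed.

(** * Arithmetic of infinite cardinals *)

Lemma card_le_inj T U (u0 : U) (A : set T) (B : set U) : A #<= B ->
  exists f : T -> U, (forall x, A x -> B (f x)) /\
    (forall x y, A x -> A y -> f x = f y -> x = y).
Proof.
move=> /card_le_relP[R [Rtot Rinj]].
have /choice[f fP] x : exists y, A x -> B y /\ R x y.
  have [Ax|nAx] := pselect (A x); last by exists u0.
  by have [y By Rxy] := Rtot _ Ax; exists y.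
exists f; split=> [x /fP[]//|x y Ax Ay e].
apply: (Rinj _ _ (f x)) => //; first by have [] := fP _ Ax.
by rewrite e; have [] := fP _ Ay.
Qed.

(** Zorn's lemma on graphs of injections from the square of [fld F] into [fld F]. If the complement
    in [A] of the field [B] of a maximal one embeds into [B], then so does [A]; otherwise a copy of
    [B] in that complement allows an extension. *)
Lemma card_setX_infinite T (A : set T) : infinite_set A -> A `*` A #<= A.
Proof.
move=> infA.
have [a0 _] : A !=set0 by apply: infinite_setN0.
have [g [gA ginj]] : exists g : nat -> T, (forall n, [set: nat] n -> A (g n)) /\
    (forall m n, [set: nat] m -> [set: nat] n -> g m = g n -> m = n).
  by apply: (card_le_inj a0); apply/infiniteP.
have {}ginj m n : g m = g n -> m = n by exact: ginj.
pose fld (F : set (T * T * T)) := [set a | exists c, F (a, a, c)].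
pose Q (F : set (T * T * T)) := [/\ (forall p c c', F (p, c) -> F (p, c') -> c = c'),
  (forall p p' c, F (p, c) -> F (p', c) -> p = p'),
  (forall a b c, F (a, b, c) -> [/\ fld F a, fld F b & fld F c]),
  (forall a b, fld F a -> fld F b -> exists c, F (a, b, c)) &
  fld F `<=` A].
pose F0 : set (T * T * T) :=
  [set x | exists m n, x = (g m, g n, g (pickle (m, n)))].
have Q0 : Q F0.
  have fld0 n : fld F0 (g n) by exists (g (pickle (n, n))), n, n.
  split.
  - by move=> p c c' [m [n [-> ->]]] [m' [n' [/ginj-> /ginj-> ->]]].
  - move=> p p' c [m [n [-> ->]]] [m' [n' [-> /ginj]]].
    by move=> /(pcan_inj pickleK)[-> ->].
  - by move=> a b c [m [n [-> -> ->]]].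
  - move=> a b [_ [m [_ [-> _ _]]]] [_ [n [_ [-> _ _]]]].
    by exists (g (pickle (m, n))), m, n.
  - by move=> a [_ [m [_ [-> _ _]]]]; exact: gA.
have [|M QM [F0M Mmax]] := @Zorn_above _ Q F0 Q0.
  move=> F FQ _ Ftot.
  have fldU X : F X -> fld X `<=` fld (\bigcup_(X in F) X).
    by move=> FX a [c Xc]; exists c, X.
  have two X Y : F X -> F Y -> exists2 Z, F Z & X `<=` Z /\ Y `<=` Z.
    move=> FX FY; have [XY|YX] := Ftot _ _ FX FY.
      by exists Y => //; split=> // x.
    by exists X => //; split=> // x.
  split.
  - move=> p c c' [X FX Xp] [Y FY Yp]; have [Z FZ [XZ YZ]] := two _ _ FX FY.
    by have [Zfun _ _ _ _] := FQ _ FZ; exact: Zfun (XZ _ Xp) (YZ _ Yp).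
  - move=> p p' c [X FX Xp] [Y FY Yp]; have [Z FZ [XZ YZ]] := two _ _ FX FY.
    by have [_ Zinj _ _ _] := FQ _ FZ; exact: Zinj (XZ _ Xp) (YZ _ Yp).
  - move=> a b c [X FX Xp]; have [_ _ /(_ _ _ _ Xp)[Xa Xb Xc] _ _] := FQ _ FX.
    by split; exact: fldU FX _ _.
  - move=> a b [c [X FX Xa]] [d [Y FY Yb]]; have [Z FZ [XZ YZ]] := two _ _ FX FY.
    have [_ _ _ + _] := FQ _ FZ => /(_ a b)[||e Ze]; last by exists e, Z.
      by exists c; exact: XZ.
    by exists d; exact: YZ.
  - by move=> a [c [X FX Xa]]; have [_ _ _ _] := FQ _ FX; apply; exists c.
have [Mfun Minj Mdom Mtot MA] := QM.
set B := fld M in Mdom Mtot MA.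
have gB n : B (g n) by exists (g (pickle (n, n))); apply: F0M; exists n, n.
have /choice[i iP] p : exists c, B p.1 -> B p.2 -> M (p, c).
  case: p => a b.
  have [[Ba Bb]|nB] := pselect (B a /\ B b).
    by have [c Mc] := Mtot _ _ Ba Bb; exists c.
  by exists a => Ba Bb; case: nB.
have iB a b : B a -> B b -> B (i (a, b)).
  by move=> Ba Bb; have [] := Mdom _ _ _ (iP (a, b) Ba Bb).
have iinj a b a' b' : B a -> B b -> B a' -> B b' -> i (a, b) = i (a', b') ->
    a = a' /\ b = b'.
  move=> Ba Bb Ba' Bb' e; have := iP (a, b) Ba Bb; rewrite e.
  by move=> /Minj/(_ (iP (a', b') Ba' Bb'))[].
have BB : B `*` B #<= B.
  apply: (@card_le_fun _ _ _ _ i) => [[a b] [] /iB/[apply]//|].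
  by move=> [a b] [a' b'] [/= Ba Bb] [/= Ba' Bb'] /iinj[]// -> ->.
have [AB|/(card_le_inj a0)[h [hA hinj]]] := card_le_total (A `\` B) B.
  have [h [hB hinj]] := card_le_inj a0 AB.
  have {}AB : A #<= B.
    apply: (@card_le_fun _ _ _ _
      (fun x => if `[<B x>] then i (g 0, x) else i (g 1, h x))) => [x Ax|x y Ax Ay].
      by case: asboolP => Bx; apply: iB => //; exact: hB.
    case: asboolP => Bx; case: asboolP => By.
    - by move=> /iinj[].
    - by move=> /iinj[]//; [exact: hB|move=> /ginj].
    - by move=> /iinj[]//; [exact: hB|move=> /ginj].
    - by move=> /iinj[]//; [exact: hB|exact: hB|move=> _; exact: hinj].
  have [h' [h'B h'inj]] := card_le_inj a0 AB.
  apply: (card_le_trans _ (card_le_trans BB (subset_card_le MA))).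
  apply: (@card_le_fun _ _ _ _ (fun p => (h' p.1, h' p.2))).
    by move=> [a b] [/h'B ? /h'B ?].
  by move=> [a b] [c d] [/= Aa Ab] [/= Ac Ad] [/h'inj-> // /h'inj->].
pose tw (t : bool) a := if t then a else h a.
(* The new pairs, with at least one coordinate in the copy of [B], are sent into the copy;
   [g (ta.*2 + tb)] records which coordinates lie in [B]. *)
pose E : set (T * T * T) := [set x | exists ta a tb b, [/\ B a, B b, ~~ (ta && tb) &
  x = (tw ta a, tw tb b, h (i (g (ta.*2 + tb), i (a, b))))]].
have hNB a : B a -> ~ B (h a) by move=> /hA[].
have twinj ta a ta' a' : B a -> B a' -> tw ta a = tw ta' a' -> ta = ta' /\ a = a'.
  case: ta ta' => -[] /= Ba Ba' e //; last by split=> //; exact: hinj.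
    by case: (hNB _ Ba'); rewrite -e.
  by case: (hNB _ Ba); rewrite e.
have twB ta a : B a -> (B (tw ta a) <-> ta).
  by case: ta => //= Ba; split=> // Bh; case: (hNB _ Ba).
have MB a b c : M (a, b, c) -> [/\ B a, B b & B c] by exact: Mdom.
have eB ta tb a b : B a -> B b -> B (i (g (ta.*2 + tb), i (a, b))).
  by move=> Ba Bb; exact: (iB _ _ (gB _) (iB _ _ Ba Bb)).
pose F := M `|` E.
have fldF x : fld F x <-> exists t a, B a /\ x = tw t a.
  split=> [[c [/MB[Bx _ _]|]]|[[] [a [Ba ->]]]].
  - by exists true, x.
  - by move=> [ta [a [tb [b [Ba Bb _ [-> _ _]]]]]]; exists ta, a.
  - by have [c Mc] := Ba; exists c; left.
  - by exists (h (i (g 0, i (a, a)))); right; exists false, a, false, a.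
have : Q F.
  split.
  - move=> [x y] c c' [Mx|[ta [a [tb [b [Ba Bb tab [-> -> ->]]]]]]].
      case=> [|[ta [a [tb [b [Ba Bb tab [xE yE ->]]]]]]]; first exact: Mfun Mx.
      have [Bx By _] := MB _ _ _ Mx.
      move: Bx By; rewrite xE yE => /(twB ta _ Ba) ta1 /(twB tb _ Bb) tb1.
      by rewrite ta1 tb1 in tab.
    case=> [Mx|].
      have [/(twB ta _ Ba) ta1 /(twB tb _ Bb) tb1 _] := MB _ _ _ Mx.
      by rewrite ta1 tb1 in tab.
    move=> [ta' [a' [tb' [b' [Ba' Bb' _]]]]].
    by case=> /twinj[]// -> -> /twinj[]// -> -> ->.
  - move=> [x y] [x' y'] c [Mx|[ta [a [tb [b [Ba Bb tab [-> -> ->]]]]]]].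
      case=> [|[ta [a [tb [b [Ba Bb tab [_ _ cE]]]]]]]; first exact: Minj Mx.
      have [_ _] := MB _ _ _ Mx; rewrite cE => Bh.
      by case: (hNB _ (eB ta tb _ _ Ba Bb)).
    case=> [Mx|].
      have [_ _ Bh] := MB _ _ _ Mx.
      by case: (hNB _ (eB ta tb _ _ Ba Bb)).
    move=> [ta' [a' [tb' [b' [Ba' Bb' _]]]]] [-> ->].
    move=> /hinj e; move: (e (eB _ _ _ _ Ba Bb) (eB _ _ _ _ Ba' Bb')) => {e}.
    move=> /iinj[]//; [exact: iB|exact: iB|].
    move=> /ginj tE /iinj[]// -> ->.
    by move: tE; case: ta {tab} => /=; case: tb; case: ta'; case: tb'.
  - move=> a b c [/MB[Ba Bb Bc]|].
      by split; apply/fldF; [exists true, a|exists true, b|exists true, c].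
    move=> [ta [a' [tb [b' [Ba Bb _ [-> -> ->]]]]]].
    split; apply/fldF; [by exists ta, a'|by exists tb, b'|].
    by exists false, (i (g (ta.*2 + tb), i (a', b'))); split=> //; exact: eB.
  - move=> x y /fldF[ta [a [Ba ->]]] /fldF[tb [b [Bb ->]]].
    have [/andP[-> ->]|tab] := boolP (ta && tb).
      by have [c Mc] := Mtot _ _ Ba Bb; exists c; left.
    by exists (h (i (g (ta.*2 + tb), i (a, b)))); right; exists ta, a, tb, b.
  - by move=> x /fldF[[] [a [Ba ->]]]; [exact: MA|have [] := hA _ Ba].
move=> /Mmax => /(_ (@subsetUl _ _ _)) FM.
case: (hNB _ (gB 0)); have /fldF[c Fc] : exists t a, B a /\ h (g 0) = tw t a.
  by exists false, (g 0).
by exists c; exact: FM.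
Qed.

(** A sequence is coded by its length and the nested pairing of its entries; the nested code is only
    decoded once the length is known. *)
Lemma card_seq_infinite (T : choiceType) (A : set T) : infinite_set A ->
  [set s : seq T | forall x, x \in s -> A x] #<= A.
Proof.
move=> infA.
have [a0 _] : A !=set0 by apply: infinite_setN0.
have [g [gA ginj]] : exists g : nat -> T, (forall n, [set: nat] n -> A (g n)) /\
    (forall m n, [set: nat] m -> [set: nat] n -> g m = g n -> m = n).
  by apply: (card_le_inj a0); apply/infiniteP.
have [i [iA iinj]] := card_le_inj a0 (card_setX_infinite infA).
have fA s : (forall x, x \in s -> A x) -> A (foldr (fun x y => i (x, y)) (g 0) s).
  elim: s => [_|x s IHs sA] /=; first exact: gA.
  apply: iA; split => /=; first by apply: sA; rewrite inE eqxx.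
  by apply: IHs => y ys; apply: sA; rewrite inE ys orbT.
apply: (@card_le_fun _ _ _ _
  (fun s => i (g (size s), foldr (fun x y => i (x, y)) (g 0) s))) => [s sA|].
  by apply: iA; split; [exact: gA|exact: fA].
move=> s t sA tA /iinj e.
have [] := e (conj (gA _ I) (fA _ sA)) (conj (gA _ I) (fA _ tA)).
move=> /ginj => /(_ I I); elim: s t {e} sA tA => [|x s IHs] [|y t]//= sA tA [sz].
have sA' z : z \in s -> A z by move=> zs; apply: sA; rewrite inE zs orbT.
have tA' z : z \in t -> A z by move=> zs; apply: tA; rewrite inE zs orbT.
have Ax : A x by apply: sA; rewrite inE eqxx.
have Ay : A y by apply: tA; rewrite inE eqxx.
by move=> /iinj e; have [-> /IHs->] := e (conj Ax (fA _ sA')) (conj Ay (fA _ tA')).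
Qed.

(** Elements of the closure are values of terms: leaves carry elements of [A], and a node labelled
    [n] selects the entry of index [n] of [c] applied to the values of its children. Terms are coded
    by finite sequences over [A]. *)
Lemma card_closure (T : choiceType) (A : set T) (c : seq T -> seq T) :
  infinite_set A -> exists M : set T, [/\ A `<=` M,
    (forall s, (forall x, x \in s -> M x) -> forall x, x \in c s -> M x) &
    M #<= A].
Proof.
move=> infA; have [a0 _] : A !=set0 by apply: infinite_setN0.
pose fix ev (t : GenTree.tree T) := match t with
  | GenTree.Leaf x => x
  | GenTree.Node n l => nth a0 (c (map ev l)) n
  end.
pose over := [set t : GenTree.tree T | forall x, inr x \in GenTree.encode t -> A x].
exists (ev @` over); split.
- move=> x Ax; exists (GenTree.Leaf x) => // y /=.
  by rewrite inE => /eqP[->].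
- move=> s sM x xc.
  have [l [lO lE]] : exists l, (forall t, t \in l -> over t) /\ map ev l = s.
    elim: s {x xc} sM => [|y s IHs] sM; first by exists [::].
    have [z zs|l [lO <-]] := IHs; first by apply: sM; rewrite inE zs orbT.
    have [t tO <-] := sM y (mem_head _ _).
    exists (t :: l); split=> // u; rewrite inE => /orP[/eqP->//|/lO//].
  exists (GenTree.Node (index x (c s)) l); last by rewrite /= lE nth_index.
  move=> y /=; rewrite inE mem_rcons inE /= => /flattenP[u /mapP[t /lO tO ->]].
  exact: tO.
have [i [iA iinj]] := card_le_inj a0 (card_setX_infinite infA).
have [g [gA ginj]] : exists g : nat -> T, (forall n, [set: nat] n -> A (g n)) /\
    (forall m n, [set: nat] m -> [set: nat] n -> g m = g n -> m = n).
  by apply: (card_le_inj a0); apply/infiniteP.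
have {}ginj m n : g m = g n -> m = n by exact: ginj.
pose lab (u : nat + T) := match u with inl n => i (g 0, g n) | inr x => i (g 1, x) end.
pose okl (u : nat + T) := if u is inr x then A x else True.
have labA u : okl u -> A (lab u).
  by case: u => [n _|x Ax]; apply: iA; split=> //=; exact: gA.
have labinj u v : okl u -> okl v -> lab u = lab v -> u = v.
  have ok2 n x : A x -> (A `*` A) (g n, x) by move=> Ax; split=> //; exact: gA.
  case: u v => [m|x] [n|y] ou ov /iinj e.
  - by have [/ginj->] := e (ok2 _ _ (gA _ I)) (ok2 _ _ (gA _ I)).
  - by have [/ginj] := e (ok2 _ _ (gA _ I)) (ok2 _ _ ov).
  - by have [/ginj] := e (ok2 _ _ ou) (ok2 _ _ (gA _ I)).
  - by have [->] := e (ok2 _ _ ou) (ok2 _ _ ov).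
apply: (card_le_trans (card_image_le _ _)).
apply: (card_le_trans _ (card_seq_infinite infA)).
have overok t u : over t -> u \in GenTree.encode t -> okl u.
  by case: u => //= x tO; exact: tO.
apply: (@card_le_fun _ _ _ _ (fun t => map lab (GenTree.encode t))) => [t tO x|].
  by move=> /mapP[u /(overok _ _ tO)/labA ? ->].
move=> t t' tO tO' e; apply: (pcan_inj (GenTree.codeK T)).
move: e (overok _ ^~ tO) (overok _ ^~ tO') => {tO tO'}.
elim: (GenTree.encode t) (GenTree.encode t') => [|u s IHs] [|v r]//= [uv sr] su rv.
rewrite (labinj u v _ _ uv); [|by apply: su; rewrite mem_head|by apply: rv; rewrite mem_head].
by congr cons; apply: IHs => // z zs; [apply: su|apply: rv]; rewrite inE zs orbT.
Qed.

(** * Sets of size less than a fixed infinite cardinal *)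

Definition small (K : Type) T (A : set T) := ~ ([set: K] #<= A).

Section Small.
Variables (K : Type).
Hypothesis infK : infinite_set [set: K].

Lemma small_le T U (A : set T) (B : set U) : A #<= B -> small K B -> small K A.
Proof. by move=> AB sB KA; apply: sB; exact: card_le_trans AB. Qed.

Lemma small_sub T (A B : set T) : A `<=` B -> small K B -> small K A.
Proof. by move=> /subset_card_le; exact: small_le. Qed.

Lemma small_finite T (A : set T) : finite_set A -> small K A.
Proof. by move=> finA /card_le_finite/(_ finA). Qed.

Lemma finite_bounded_seqs (T : choiceType) (Y : set T) n : finite_set Y ->
  finite_set [set s : seq T | (forall x, x \in s -> Y x) /\ size s < n].
Proof.
move=> finY; elim: n => [|n IHn].
  by rewrite (_ : [set _ | _] = set0)//; apply/seteqP; split=> // s [].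
apply: (@sub_finite_set _ _ ([set [::]] `|`
    [set x :: s | x in Y & s in [set s | (forall x, x \in s -> Y x) /\ size s < n]])).
  move=> [|x s] [sY' sn]; [by left|right].
  exists x; first by apply: sY'; rewrite mem_head.
  by exists s => //; split=> // y ys; apply: sY'; rewrite inE ys orbT.
by rewrite finite_setU; split; [exact: finite_set1|exact: finite_image2].
Qed.

(** If [Y] is infinite, the union lies in a closure of [Y] of the same size, so singular cardinals
    cause no trouble; if [Y] is finite, the bound [n] on the lengths makes the index set finite. *)
Lemma small_bigcup_seq (T : choiceType) (Y : set T) (F : seq T -> set T) n :
  small K Y -> (forall s, finite_set (F s)) ->
  small K (\bigcup_(s in [set s | (forall x, x \in s -> Y x) /\ size s < n]) F s).
Proof.
move=> sY finF; have [finY|infY] := pselect (finite_set Y).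
  apply: small_finite; apply: bigcup_finite => [|s _]; last exact: finF.
  exact: finite_bounded_seqs.
have /choice[c cP] s : exists t : seq T, F s `<=` [set` t].
  by have /finite_seqP[t ->] := finF s; exists t.
have [M [YM Mc MY]] := card_closure c infY.
apply: small_le sY; apply: card_le_trans MY; apply: subset_card_le.
by move=> x [s [sY' _] /cP xs]; apply: (Mc s) => // y /sY' /YM.
Qed.

(** If [h] embeds [A] into an infinite [B], the union lies in the closure of [B] under preimages
    along [h]. *)
Lemma small_setU (T : choiceType) (A B : set T) :
  small K A -> small K B -> small K (A `|` B).
Proof.
wlog AB : A B / A #<= B.
  move=> wl; have [AB|BA] := card_le_total A B; first exact: wl.
  by move=> sA sB; rewrite setUC; exact: wl.
move=> sA sB; have [finB|infB] := pselect (finite_set B).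
  by apply: small_finite; rewrite finite_setU; split=> //; exact: card_le_finite AB finB.
have [b0 _] : B !=set0 by apply: infinite_setN0.
have [h [hB hinj]] := card_le_inj b0 AB.
have [M [BM Mc MB]] := card_closure
  (fun s => filter (fun x => `[<A x /\ h x \in s>]) (if s is y :: _ then
     [:: xget y [set x | A x /\ h x = y]] else [::])) infB.
apply: small_le sB; apply: card_le_trans MB; apply: subset_card_le.
move=> x [Ax|/BM//]; apply: (Mc [:: h x]).
  by move=> y; rewrite inE => /eqP->; apply/BM/hB.
rewrite mem_filter; apply/andP; split; first by apply/asboolP; rewrite inE.
rewrite inE eq_sym; apply/eqP; apply: xget_unique => // y [Ay].
by move/hinj; exact.
Qed.

(** As [K] is uncountable, a countably infinite set can be added to [A]; closing an infinite set
    does not raise its cardinality. *)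
Lemma small_closure (T : choiceType) (A : set T) (c : seq T -> seq T) :
  small K [set: nat] -> small K A -> exists M : set T, [/\ A `<=` M,
    (forall s, (forall x, x \in s -> M x) -> forall x, x \in c s -> M x) &
    small K M].
Proof.
move=> sN sA; have [finT|/infiniteP NT] := pselect (finite_set [set: T]).
  by exists setT; split=> //; exact: small_finite.
have [B [infB sB]] : exists B : set T, infinite_set B /\ small K B.
  have [g _] : {g : nat -> T | True}.
    by apply: cid; have /infiniteP/infinite_setN0[x _] := NT; exists (fun=> x).
  have [f [_ finj]] := card_le_inj (g 0) NT.
  have fN : range f #= [set: nat] by apply: inj_card_eq => x y _ _; exact: finj.
  exists (range f); split; first by apply/infiniteP; rewrite (card_le_eqr fN).
  by apply: small_le sN; rewrite (card_le_eql fN).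
have [|M [AM Mc MA]] := card_closure c (_ : infinite_set (A `|` B)).
  by apply: contra_not infB; apply: sub_finite_set; exact: subsetUr.
exists M; split=> //; first by move=> x Ax; apply: AM; left.
by apply: small_le MA _; exact: small_setU.
Qed.

Lemma finite_small T (A : set T) : ~ small K [set: nat] -> small K A -> finite_set A.
Proof.
move=> /contrapT KN sA; apply: contrapT => /infiniteP NA; apply: sA.
exact: card_le_trans NA.
Qed.

End Small.

(** * Menger's theorem *)

Section Menger.
Variable T : eqType.
Implicit Types (e : rel T) (E : seq (T * T)) (A B R s : seq T).

Lemma first_hit (P : pred T) s : has P s ->
  exists p z q, [/\ s = p ++ z :: q, P z & ~~ has P p].
Proof.
elim: s => //= x s IHs; have [Px _|nPx /= /IHs[p [z [q [-> Pz Pp]]]]] := boolP (P x).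
  by exists [::], x, s.
by exists (x :: p), z, q; rewrite /= negb_or nPx.
Qed.

Definition walk e A B s :=
  if s is x :: p then [&& x \in A, path e x p & last x p \in B] else false.

Definition arc E : rel T := fun x y => (x, y) \in E.

Definition separates e A B R := forall s, walk e A B s -> has (mem R) s.

Lemma sub_walk e e' A A' B B' s : subrel e e' -> {subset A <= A'} ->
  {subset B <= B'} -> walk e A B s -> walk e' A' B' s.
Proof.
case: s => //= x p ee' AA' BB' /and3P[/AA'-> /(sub_path ee')-> /BB'->//].
Qed.

Lemma walk_shorten e A B s : walk e A B s ->
  exists t, [/\ walk e A B t, uniq t & {subset t <= s}].
Proof.
case: s => //= x p /and3P[xA /shortenP[q qp Uq sqp] lB].
exists (x :: q); split => //=; first by rewrite xA qp lB.
by move=> z; rewrite !inE => /orP[->//|/sqp->]; rewrite orbT.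
Qed.

Lemma walk_prefix e A B p v q : walk e A B (p ++ v :: q) ->
  walk e A [:: v] (rcons p v).
Proof.
case: p => [|x p] /=; first by case/and3P=> ->; rewrite inE eqxx.
rewrite cat_path rcons_path last_rcons inE eqxx andbT /=.
by case/and3P=> -> /and3P[-> ->].
Qed.

Lemma walk_suffix e A B p v q : walk e A B (p ++ v :: q) ->
  walk e [:: v] B (v :: q).
Proof.
rewrite /= inE eqxx /=; case: p => [|x p] /=; first by case/and3P=> _ -> ->.
by rewrite cat_path last_cat /= => /and3P[_ /and3P[_ _ ->] ->].
Qed.

Lemma walk_glue e A B p v q : walk e A [:: v] (rcons p v) ->
  walk e [:: v] B (v :: q) -> walk e A B (p ++ v :: q).
Proof.
case: p => [|x p] /=; first by case/and3P=> -> _ _ /and3P[_ -> ->].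
rewrite rcons_path cat_path last_cat /= => /and3P[-> /andP[-> ->] _].
by case/and3P=> _ -> ->.
Qed.

Lemma walk_avoid_tail a E A B p v : a.1 \notin p ->
  walk (arc (a :: E)) A B (rcons p v) -> walk (arc E) A B (rcons p v).
Proof.
case: p => [|x p] //=; rewrite !rcons_path last_rcons => ap.
case/and3P=> -> /andP[pp plast] ->; rewrite /= andbT.
have arcE y z : y \in x :: p -> arc (a :: E) y z -> arc E y z.
  rewrite /arc inE => yp /orP[/eqP aE|//].
  by case/negP: ap; rewrite -aE.
rewrite (arcE _ _ _ plast) ?mem_last// andbT.
elim: p x ap pp {plast} arcE => //= y p IHp x; rewrite inE negb_or => /andP[_ ap].
case/andP=> xy pp arcE; rewrite (arcE _ _ _ xy) ?mem_head//=.
by apply: IHp => // z t zp; apply: arcE; rewrite inE zp orbT.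
Qed.

Lemma walk_avoid_head a E A B v q : a.2 \notin q ->
  walk (arc (a :: E)) A B (v :: q) -> walk (arc E) A B (v :: q).
Proof.
rewrite /= => aq /and3P[-> + ->]; rewrite andbT.
elim: q v aq => //= y q IHq v; rewrite inE negb_or => /andP[ay aq].
case/andP=> + /(IHq _ aq) ->; rewrite andbT /arc inE => /orP[/eqP aE|//].
by move: ay; rewrite -aE eqxx.
Qed.

Lemma separates_tail x y E A B R : separates (arc E) A B R ->
  separates (arc ((x, y) :: E)) A B (x :: R).
Proof.
move=> sepR s ws; have [xs|xs] := boolP (x \in s).
  by apply/hasP; exists x => //=; rewrite mem_head.
case/lastP: s => // s v in ws xs *.
have /sepR/hasP[z zs /= zR] : walk (arc E) A B (rcons s v).
  by apply: walk_avoid_tail ws => /=; apply: contra xs; rewrite mem_rcons inE orbC => ->.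
by apply/hasP; exists z => //=; rewrite inE zR orbT.
Qed.

Lemma separates_head x y E A B R : separates (arc E) A B R ->
  separates (arc ((x, y) :: E)) A B (y :: R).
Proof.
move=> sepR s ws; have [xs|xs] := boolP (y \in s).
  by apply/hasP; exists y => //=; rewrite mem_head.
have /sepR/hasP[z zs /= zR] : walk (arc E) A B s.
  case: s => // v s in ws xs *; apply: walk_avoid_head ws => /=.
  by apply: contra xs; rewrite inE orbC => ->.
by apply/hasP; exists z => //=; rewrite inE zR orbT.
Qed.

Definition linkage e A B n (f : nat -> seq T) :=
  (forall i, i < n -> walk e A B (f i)) /\
  (forall i j v, i < n -> j < n -> v \in f i -> v \in f j -> i = j).

Lemma linkage_shorten e A B n f : linkage e A B n f ->
  exists2 g, linkage e A B n g & forall i, i < n -> uniq (g i).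
Proof.
move=> [fw fd].
have /choice[g gP] i : exists t, i < n -> [/\ walk e A B t, uniq t & {subset t <= f i}].
  have [/fw/walk_shorten[t tP]|ni] := boolP (i < n); last by exists [::].
  by exists t.
exists g; last by move=> i /gP[].
split=> [i /gP[]//|i j v ni nj].
by have [_ _ gf] := gP _ ni; have [_ _ gf'] := gP _ nj => /gf + /gf'; exact: fd.
Qed.

(** The disjoint walks pick [n] distinct vertices of [R], hence all of them, so they can be named by
    the vertices at which they will be glued. *)
Lemma linkage_index (h : seq T -> T) e A B R n f : linkage e A B n f ->
  (forall i, i < n -> h (f i) \in f i) -> (forall i, i < n -> h (f i) \in R) ->
  n = size R -> exists F : T -> seq T,
    [/\ forall r, r \in R -> exists2 i, i < n & F r = f i,
        forall r, r \in R -> h (F r) = r &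
        forall r r' v, r \in R -> r' \in R -> v \in F r -> v \in F r' -> r = r'].
Proof.
move=> [fw fd] hf hR nR.
pose L := [seq h (f i) | i <- iota 0 n].
have UL : uniq L.
  rewrite map_inj_in_uniq ?iota_uniq// => i j; rewrite !mem_iota !add0n /= => ni nj ij.
  by apply: (fd _ _ (h (f i))) => //; [exact: hf|rewrite ij; exact: hf].
have LR : {subset L <= R}.
  by move=> _ /mapP[i + ->]; rewrite mem_iota add0n => /hR.
have szL : size R <= size L by rewrite size_map size_iota nR.
have [_ LRi] := uniq_min_size UL LR szL.
have /choice[F FP] r : exists s, r \in R -> (exists2 i, i < n & s = f i) /\ h s = r.
  have [rR|_] := boolP (r \in R); last by exists [::].
  have /mapP[i] : r \in L by rewrite LRi.
  by rewrite mem_iota add0n => ni rE; exists (f i) => _; split=> //; exists i.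
exists F; split=> [r /FP[]//|r /FP[]//|r r' v /FP[[i ni ->] <-] /FP[[j nj ->] <-]].
by move=> vi vj; rewrite (fd i j v).
Qed.

(* Induction on the arcs, following Goering: if the deletion of [(x, y)] creates a separator [R] of
   size [n - 1], a linkage from [A] to [x :: R] and one from [y :: R] to [B] are glued. *)
Lemma menger_arcs E A B n :
  (forall R, separates (arc E) A B R -> n <= size R) ->
  exists2 f, linkage (arc E) A B n f & forall i, i < n -> uniq (f i).
Proof.
elim: E A B n => [|[x y] E IHE] A B n sepn.
  pose R := undup [seq z <- A | z \in B].
  have /sepn nR : separates (arc [::]) A B R.
    case=> // z [|u p] /and3P[zA] //= _ zB.
    by rewrite orbF mem_undup mem_filter zB.
  case ER: R nR => [|z R'] nR.
    by exists (fun=> [::]) => //; split=> i; case: n {sepn} nR.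
  exists (fun i => [:: nth z R i]) => //; split=> [i ni|i j v ni nj].
    have /= : nth z R i \in R by rewrite mem_nth// ER (leq_trans ni).
    by rewrite {1}/R mem_undup mem_filter => /andP[-> ->].
  rewrite !inE => /eqP-> /eqP ij; apply/eqP.
  by rewrite -(nth_uniq z _ _ (undup_uniq [seq z <- A | z \in B])) -?/R ?ij//
    ER (leq_trans _ nR).
have [sepE|] := pselect (forall R, separates (arc E) A B R -> n <= size R).
  have [f [fw fd] Uf] := IHE _ _ _ sepE; exists f => //; split=> // i /fw.
  by apply: sub_walk => // u v; rewrite /arc inE => ->; rewrite orbT.
move=> /existsNP[R /not_implyP[sepR]] /negP; rewrite -ltnNge => Rn.
have sepx := @separates_tail x y _ _ _ _ sepR.
have sepy := @separates_head x y _ _ _ _ sepR.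
have nR : n = (size R).+1.
  by apply/eqP; rewrite eqn_leq Rn andbT; have := sepn _ sepx.
have uniq_sep S : size S = n -> separates (arc ((x, y) :: E)) A B S -> uniq S.
  move=> Sn sepS; rewrite -[uniq S]negbK -ltn_size_undup -leqNgt Sn; apply: sepn.
  by move=> s /sepS; rewrite (eq_has (mem_undup S)).
have Ux := uniq_sep (x :: R) (esym nR) sepx.
have Uy := uniq_sep (y :: R) (esym nR) sepy.
(* A walk cut at its first vertex in [x :: R] does not use the new arc, which starts in [x]; so [Q]
   meets every walk from [A] to [B]. *)
have /IHE[f flink Uf] : forall Q, separates (arc E) A (x :: R) Q -> n <= size Q.
  move=> Q sepQ; apply: sepn => s ws.
  have [p [z [q [sE zR pR]]]] := first_hit (sepx _ ws).
  rewrite sE in ws *; have {}ws := walk_prefix ws.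
  have /sepQ : walk (arc E) A (x :: R) (rcons p z).
    apply: (walk_avoid_tail (a := (x, y))) => /=; last first.
      by apply: sub_walk ws => // u; rewrite inE => /eqP->.
    by apply: contra pR => xp; apply/hasP; exists x => //=; exact: mem_head.
  by rewrite -cat_rcons has_cat => ->.
have /IHE[g glink Ug] : forall Q, separates (arc E) (y :: R) B Q -> n <= size Q.
  move=> Q sepQ; apply: sepn => s ws; have := sepy _ ws.
  rewrite -has_rev => /first_hit[p [z [q [/(congr1 rev) + zR pR]]]].
  rewrite revK rev_cat rev_cons cat_rcons => sE.
  rewrite sE in ws *; have {}ws := walk_suffix ws.
  have /sepQ : walk (arc E) (y :: R) B (z :: rev p).
    apply: (walk_avoid_head (a := (x, y))) => /=; last first.
      by apply: sub_walk ws => // u; rewrite inE => /eqP->.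
    by apply: contra pR; rewrite mem_rev => yp; apply/hasP; exists y => //=; exact: mem_head.
  by rewrite has_cat => ->; rewrite orbT.
have lastf i : i < n -> last x (f i) \in f i /\ last x (f i) \in x :: R.
  by case: flink => + _ => /[apply]; case: (f i) => //= u p /and3P[_ _ ->]; rewrite mem_last.
have headg i : i < n -> head x (g i) \in g i /\ head x (g i) \in y :: R.
  by case: glink => + _ => /[apply]; case: (g i) => //= u p /and3P[-> _ _]; rewrite mem_head.
have [F [Ff Flast Fdisj]] := linkage_index flink (fun i ni => (lastf i ni).1)
  (fun i ni => (lastf i ni).2) nR.
have [H [Hg Hhead Hdisj]] := linkage_index glink (fun i ni => (headg i ni).1)
  (fun i ni => (headg i ni).2) nR.
have Fw r : r \in x :: R -> exists p, [/\ F r = rcons p r, uniq (F r) &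
    walk (arc E) A [:: r] (F r)].
  move=> rR; have [i ni Fi] := Ff _ rR; move: (Flast _ rR).
  rewrite Fi; case: flink => /(_ _ ni) + _; have := Uf _ ni.
  case/lastP: (f i) => // p v Up; rewrite last_rcons => wp <-; exists p; split=> //.
  by rewrite -cats1 in wp; exact: walk_prefix wp.
have Hw r : r \in y :: R -> exists q, [/\ H r = r :: q, uniq (H r) &
    walk (arc E) [:: r] B (H r)].
  move=> rR; have [i ni Hi] := Hg _ rR; move: (Hhead _ rR).
  rewrite Hi; case: glink => /(_ _ ni) + _; have := Ug _ ni.
  case: (g i) => // v q Uq wq /= <-; exists q; split=> //.
  by rewrite -[v :: q]cat0s in wq; exact: walk_suffix wq.
have FE r v : r \in x :: R -> v \in x :: R -> v \in F r -> v = r.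
  move=> rR vR vF; apply: (Fdisj _ _ v) => //; have [p [-> _ _]] := Fw _ vR.
  by rewrite mem_rcons mem_head.
have HE r v : r \in y :: R -> v \in y :: R -> v \in H r -> v = r.
  move=> rR vR vH; apply: (Hdisj _ _ v) => //; have [p [-> _ _]] := Hw _ vR.
  by rewrite mem_head.
(* Otherwise the two pieces would form a walk from [A] to [B] avoiding [R]. *)
have FH r r' v : r \in x :: R -> r' \in y :: R -> v \in F r -> v \in H r' -> v \in R.
  move=> rR rR' vF vH; apply: contraT => vNR.
  have [p [FrE UF wF]] := Fw _ rR; have [q [HrE UH wH]] := Hw _ rR'.
  have FNR := FE _ _ rR; have HNR := HE _ _ rR'.
  case/splitPr: (F r) / vF FrE UF wF FNR => p1 p2 FrE UF /walk_prefix wF FNR.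
  case/splitPr: (H r') / vH HrE UH wH HNR => q1 q2 HrE UH /walk_suffix wH HNR.
  have /sepR/hasP[z] := walk_glue wF wH.
  rewrite mem_cat inE => zin /= zR0; have zR : z \in R := zR0.
  have zNv : z != v by apply: contraNneq vNR => <-.
  have [zp|zp] := boolP (z \in p1).
    have zr : z = r by apply: FNR; [rewrite inE zR orbT|rewrite mem_cat zp].
    have : r \in v :: p2.
      have : last x (p1 ++ v :: p2) = r by rewrite FrE last_rcons.
      by rewrite last_cat /= => <-; exact: mem_last.
    by move: UF; rewrite -zr cat_uniq => /and3P[_ /hasPn/(_ z) + _] zr' => /(_ zr')/negP.
  move: zin; rewrite (negbTE zp) (negbTE zNv) /= => zq.
  have zr : z = r'.
    by apply: HNR; [rewrite inE zR orbT|rewrite mem_cat inE zq !orbT].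
  case: q1 => [|u q1] in HrE UH HNR *.
    by case: HrE => vr; rewrite vr zr eqxx in zNv.
  case: HrE => ur _; move: UH; rewrite ur -zr /= => /andP[+ _].
  by rewrite mem_cat inE zq !orbT.
(* The walk ending in [x] continues through the new arc along all of [H y]; any other one shares the
   vertex [r] with its continuation, where [r] is dropped. *)
pose tl r := if r == x then H y else behead (H r).
pose nx r := if r == x then y else r.
have nxR r : r \in x :: R -> nx r \in y :: R.
  rewrite /nx !inE; case: (r == x) => /= [_|->]; first by rewrite eqxx.
  by rewrite orbT.
have tlH r v : r \in x :: R -> v \in tl r -> v \in H (nx r).
  rewrite /tl /nx; case: eqP => // _ _; exact: mem_behead.
have nxinj r r' : r \in x :: R -> r' \in x :: R -> nx r = nx r' -> r = r'.
  have /andP[yR _] := Uy.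
  rewrite /nx !inE; case: eqP => [->|_]; case: eqP => [->//|_] //= rR rR' e.
    by rewrite e rR' in yR.
  by rewrite -e rR in yR.
have Fnx r r' v : r \in x :: R -> r' \in x :: R -> v \in F r -> v \in tl r' -> r = r'.
  move=> rR rR' vF /(tlH _ _ rR') vH; have vR := FH _ _ _ rR (nxR _ rR') vF vH.
  have vr := FE _ _ rR _ vF; have vr' := HE _ _ (nxR _ rR') _ vH.
  have {}vr : v = r by apply: vr; rewrite inE vR orbT.
  have {}vr' : v = nx r' by apply: vr'; rewrite inE vR orbT.
  move: vr'; rewrite /nx; case: eqP => [_ vy|_ <-//].
  by move: Uy; rewrite /= -vy vR.
suff [h hl] : exists h, linkage (arc ((x, y) :: E)) A B n h.
  by have [h' hl' Uh'] := linkage_shorten hl; exists h'.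
exists (fun i => let r := nth x (x :: R) i in F r ++ tl r).
have nthR i : i < n -> nth x (x :: R) i \in x :: R by move=> ni; rewrite mem_nth//= -nR.
have nthI i j : i < n -> j < n -> nth x (x :: R) i = nth x (x :: R) j -> i = j.
  by move=> ni nj /eqP; rewrite nth_uniq ?[size _]/= -?nR// => /eqP.
have EE : subrel (arc E) (arc ((x, y) :: E)).
  by move=> u v; rewrite /arc inE => ->; rewrite orbT.
split=> [i ni|i j v ni nj] /=.
  move: (nth _ _ i) (nthR _ ni) => r rR.
  have [p [FrE _ wF]] := Fw _ rR; have [q [HrE _ wH]] := Hw _ (nxR _ rR).
  rewrite FrE cat_rcons; rewrite FrE in wF; apply: walk_glue.
    by apply: sub_walk wF.
  move: HrE wH; rewrite /tl /nx; case: eqP => [-> -> wH|_ -> wH].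
    move: wH; rewrite /= !inE !eqxx /= => /andP[yq ->]; rewrite /arc inE eqxx /= andbT.
    exact: sub_path yq.
  exact: (sub_walk EE (fun z h => h) (fun z h => h) wH).
rewrite !(mem_cat v) => /orP[vi|vi] /orP[vj|vj]; apply: nthI => //.
- exact: Fdisj (nthR _ ni) (nthR _ nj) vi vj.
- exact: Fnx (nthR _ ni) (nthR _ nj) vi vj.
- exact/esym/(Fnx _ _ _ (nthR _ nj) (nthR _ ni) vj vi).
- apply: nxinj (nthR _ ni) (nthR _ nj) _.
  exact: Hdisj (nxR _ (nthR _ ni)) (nxR _ (nthR _ nj)) (tlH _ _ (nthR _ ni) vi)
    (tlH _ _ (nthR _ nj) vj).
Qed.

(* Branching over the vertices of a walk that avoids [Q]: a separator containing [Q] contains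
   one of them. *)
Lemma finite_walks e A B n (Q : seq T) j : uniq Q -> size Q + j = n ->
  (forall R, size R < n -> exists2 s, walk e A B s & ~~ has (mem R) s) ->
  exists2 E, (forall x y, arc E x y -> e x y) &
    forall R, {subset Q <= R} -> separates (arc E) A B R -> n <= size R.
Proof.
move=> + + avoid; elim: j Q => [|j IHj] Q UQ Qn.
  by exists [::] => // R QR _; rewrite -Qn addn0; exact: uniq_leq_size.
have [s ws sQ] : exists2 s, walk e A B s & ~~ has (mem Q) s.
  by apply: avoid; rewrite -Qn -addSnnS leq_addr.
have /choice[F FP] v : exists E, v \in s -> (forall x y, arc E x y -> e x y) /\
    forall R, {subset v :: Q <= R} -> separates (arc E) A B R -> n <= size R.
  have [vs|_] := boolP (v \in s); last by exists [::].
  have [||E Ee EP] := IHj (v :: Q); last by exists E.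
    by rewrite /= UQ andbT; apply: contra sQ => vQ; apply/hasP; exists v.
  by rewrite -Qn /= addSnnS.
pose L := [seq p <- [seq (u, v) | u <- s, v <- s] | e p.1 p.2].
exists (L ++ flatten (map F s)) => [x y|R QR sepR].
  rewrite /arc mem_cat mem_filter => /orP[/andP[]//|].
  by case/flattenP=> _ /mapP[v /FP[Fe _] ->]; exact: Fe.
have /sepR/hasP[v vs /= vR] : walk (arc (L ++ flatten (map F s))) A B s.
  case: s @L ws {sQ FP sepR} => // z p L /and3P[zA zp zB]; apply/and3P; split=> //.
  apply: (sub_in_path _ (allss (z :: p)) zp) => u v us vs euv.
  rewrite /arc mem_cat mem_filter; apply/orP; left; apply/andP; split=> //.
  exact: allpairs_f.
have [_ Fn] := FP _ vs; apply: Fn => [u|t wt].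
  by rewrite inE => /orP[/eqP->//|/QR].
apply: sepR; apply: sub_walk wt => // u w uw; rewrite /arc mem_cat; apply/orP; right.
by apply/flattenP; exists (F v) => //; exact: map_f.
Qed.

(** Finitely many arcs already force all separators to have at least [n] vertices, which gives
    access to the induction on a list of arcs. *)
Theorem menger e A B n :
  (forall R, size R < n -> exists2 s, walk e A B s & ~~ has (mem R) s) ->
  exists2 f, linkage e A B n f & forall i, i < n -> uniq (f i).
Proof.
move=> avoid.
have [//|//|E Ee sepE] := @finite_walks e A B n [::] n _ _ avoid.
have [|f [fw fd] Uf] := @menger_arcs E A B n; first by move=> R; exact: sepE.
by exists f => //; split=> // i /fw; apply: sub_walk => // x y; exact: Ee.
Qed.
End Menger.

(** * Boundaries and submodularity *)

Section AtMost.
Variable T : choiceType.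
Implicit Types (A B C D : set T) (s : seq T).

Definition atmost n A := exists2 s : seq T, size s <= n & A `<=` [set` s].

Lemma atmost_sub n A B : A `<=` B -> atmost n B -> atmost n A.
Proof. by move=> AB [s sn Bs]; exists s => // x /AB/Bs. Qed.

Lemma atmost_leq m n A : m <= n -> atmost m A -> atmost n A.
Proof. by move=> mn [s sm As]; exists s => //; exact: leq_trans mn. Qed.

Lemma atmost_seq s : atmost (size s) [set` s].
Proof. by exists s. Qed.

Lemma atmost_finite n A : atmost n A -> finite_set A.
Proof. by move=> [s _ As]; apply: sub_finite_set As (finite_seq s). Qed.

Lemma atmost_uniq n A s : atmost n A -> uniq s -> [set` s] `<=` A -> size s <= n.
Proof.
move=> [t tn At] Us sA; apply: leq_trans tn; apply: uniq_leq_size => // x xs.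
exact/At/sA.
Qed.

Lemma atmostPn n A : ~ atmost n A ->
  exists s, [/\ uniq s, size s = n.+1 & [set` s] `<=` A].
Proof.
move=> nA; suff [s [Us sz sA]] : exists s, [/\ uniq s, size s = n.+1 & [set` s] `<=` A].
  by exists s.
elim: {-2}n.+1 (leqnn n.+1) => [|m IHm] mn; first by exists [::].
have [s [Us sm sA]] := IHm (ltnW mn).
have [x Ax xs] : exists2 x, A x & x \notin s.
  apply: contrapT => nx; apply: nA; exists s; first by rewrite sm.
  by move=> x Ax; apply: contrapT => xs; apply: nx; exists x => //; exact/negP.
exists (x :: s); split; rewrite /= ?xs ?sm// => y /=.
by rewrite inE => /orP[/eqP->|/sA].
Qed.

Lemma atmost_exact n A : atmost n A ->
  exists s, [/\ uniq s, size s <= n & A = [set` s]].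
Proof.
move=> [s sn As]; exists (undup (filter (fun x => `[<A x>]) s)); split.
- exact: undup_uniq.
- by apply: leq_trans (size_undup _) _; rewrite size_filter (leq_trans (count_size _ _)).
- apply/seteqP; split=> x /=; rewrite mem_undup mem_filter.
    by move=> Ax; rewrite (As _ Ax) andbT; exact/asboolP.
  by case/andP=> /asboolP.
Qed.

(** Each vertex is counted at most as often in [C] and [D] together as in [A] and [B] together.
    Submodularity of boundaries reduces to these two inclusions. *)
Lemma atmost_count A B C D p q : C `|` D `<=` A `|` B -> C `&` D `<=` A `&` B ->
  atmost p A -> atmost q B ->
  exists i j, [/\ i + j <= p + q, atmost i C & atmost j D].
Proof.
move=> CDU CDI /atmost_exact[a [Ua ap AE]] /atmost_exact[b [Ub bq BE]].
pose U := undup (a ++ b).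
pose cnt (X : set T) := count (fun x => `[<X x>]) U.
have cntX (X : set T) : X `<=` A `|` B -> atmost (cnt X) X.
  move=> XU; exists (filter (fun x => `[<X x>]) U); first by rewrite size_filter.
  move=> x Xx /=; rewrite mem_filter mem_undup mem_cat; apply/andP; split.
    exact/asboolP.
  by apply/orP; have := XU _ Xx; rewrite AE BE.
have cnt_le (s : seq T) : uniq s -> cnt [set` s] <= size s.
  move=> Us; rewrite /cnt -size_filter; apply: uniq_leq_size.
    exact/filter_uniq/undup_uniq.
  by move=> x; rewrite mem_filter => /andP[/asboolP].
exists (cnt C), (cnt D); split.
- apply: (@leq_trans (cnt A + cnt B)); last first.
    by rewrite leq_add// ?AE ?BE (leq_trans (cnt_le _ _)).
  rewrite /cnt; elim: (U) => //= x U' IHU.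
  rewrite addnACA [leqRHS]addnACA leq_add//.
  have := CDU x; have := CDI x => /=.
  by do 4 case: asboolP => ? //=; move=> h h'; exfalso; (have [] // := h _)
    || (have [] // := h' _); tauto.
- by apply: cntX => x Cx; apply: CDU; left.
- by apply: cntX => x Dx; apply: CDU; right.
Qed.

End AtMost.

(** * Reachability after the deletion of a set of vertices *)

Section Reach.
Variable G : sgraph.
Implicit Types (D : set G) (x y z : G).

Definition reach D x y :=
  exists p, [/\ path (@adj G) x p, last x p = y & forall z, z \in x :: p -> ~ D z].

Lemma reach_refl D x : ~ D x -> reach D x x.
Proof. by move=> Dx; exists [::]; split=> // z; rewrite inE => /eqP->. Qed.

Lemma reach_out D x y : reach D x y -> ~ D x /\ ~ D y.
Proof.
move=> [p [_ <- pD]]; split; apply: pD; first exact: mem_head.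
exact: mem_last.
Qed.

Lemma reach_step D x y z : reach D x y -> adj y z -> ~ D z -> reach D x z.
Proof.
move=> [p [px py pD]] yz Dz; exists (rcons p z); split.
- by rewrite rcons_path px py.
- by rewrite last_rcons.
- by move=> t; rewrite -rcons_cons mem_rcons inE => /orP[/eqP->|/pD].
Qed.

Lemma reach_ind D x (P : G -> Prop) : P x ->
  (forall y z, reach D x y -> P y -> adj y z -> ~ D z -> P z) ->
  forall y, reach D x y -> P y.
Proof.
move=> Px Pstep y [p [px <- pD]].
elim/last_ind: p px pD => // p z IHp; rewrite rcons_path last_rcons => /andP[px pz] pD.
have pD' t : t \in x :: p -> ~ D t.
  by move=> tp; apply: pD; rewrite -rcons_cons mem_rcons inE tp orbT.
apply: Pstep pz _; [by exists p|exact: IHp|].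
by apply: pD; rewrite -rcons_cons mem_rcons inE eqxx.
Qed.

Lemma reach_trans D x y z : reach D x y -> reach D y z -> reach D x z.
Proof.
move=> xy; move: z; apply: reach_ind => // z t _ xz zt Dt.
exact: reach_step zt Dt.
Qed.

Lemma reach_sym D x y : reach D x y -> reach D y x.
Proof.
move=> xy; have [Dx _] := reach_out xy; move: y xy.
apply: reach_ind => [|y z xy yx yz Dz]; first exact: reach_refl.
have [_ Dy] := reach_out xy; apply: reach_trans yx.
by apply: reach_step (reach_refl Dz) _ Dy; rewrite adj_sym.
Qed.

End Reach.

Section Boundary.
Variable G : sgraph.
Implicit Types (S B C Z : set G).

(* The vertices of [S] count as having a neighbour outside. *)
Definition bd S B := [set v | B v /\ (S v \/ exists2 u, adj v u & ~ B u)].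
(** The separation encoded by [B] has the sides [B] and the complement of [inter S B], the far side,
    which contains [S]; they intersect in [bd S B]. *)
Definition inter S B := [set v | [/\ B v, ~ S v & forall u, adj v u -> B u]].

Lemma interP S B v : B v -> ~ bd S B v -> inter S B v.
Proof.
move=> Bv nbd; split=> // [Sv|u vu]; first by apply: nbd; split; [|left].
by apply: contrapT => Bu; apply: nbd; split=> //; right; exists u.
Qed.

Lemma inter_nbd S B v : inter S B v -> ~ bd S B v.
Proof. by move=> [_ Sv nB] [_ [//|[u /nB]]]. Qed.

Lemma inter_sub S B : inter S B `<=` B.
Proof. by move=> v []. Qed.

Lemma inter_mono S B C : B `<=` C -> inter S B `<=` inter S C.
Proof. by move=> BC v [/BC Cv Sv nB]; split=> // u /nB/BC. Qed.

Lemma bd_sub S B : bd S B `<=` B.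
Proof. by move=> v []. Qed.

Lemma bd_subS S S' B : S `<=` S' -> bd S B `<=` bd S' B.
Proof. by move=> SS' v [Bv [/SS'|]]; split=> //; [left|right]. Qed.

Lemma bd_setIU S B C p q : atmost p (bd S B) -> atmost q (bd S C) ->
  exists i j, [/\ i + j <= p + q, atmost i (bd S (B `&` C)) &
    atmost j (bd S (B `|` C))].
Proof.
apply: atmost_count => v.
  case=> [[[Bv Cv] [Sv|[u vu /not_andP[Bu|Cu]]]]|[BCv [Sv|[u vu /not_orP[Bu Cu]]]]].
  - by left; split; [|left].
  - by left; split=> //; right; exists u.
  - by right; split=> //; right; exists u.
  - by case: BCv => ?; [left|right]; split=> //; left.
  - by case: BCv => ?; [left|right]; split=> //; right; exists u.
move=> [[[Bv Cv] _] [_ [Sv|[u vu /not_orP[Bu Cu]]]]].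
  by split; split=> //; left.
by split; split=> //; right; exists u.
Qed.

(** Submodularity with one separation reversed: the corners are where [B] meets the far side of [C]
    and where [C] meets the far side of [B]. *)
Lemma bd_setD S B C p q : atmost p (bd S B) -> atmost q (bd S C) ->
  exists i j, [/\ i + j <= p + q, atmost i (bd S (B `\` inter S C)) &
    atmost j (bd S (C `\` inter S B))].
Proof.
have main B' C' v : bd S (B' `\` inter S C') v ->
    ~ inter S C' v /\ (bd S B' v \/ bd S C' v /\ B' v).
  move=> [[B'v Cv] h]; split=> //; case: h => [Sv|[u vu /not_andP[B'u|/contrapT Cu]]].
  - by left; split=> //; left.
  - by left; split=> //; right; exists u.
  - right; split=> //; apply: contrapT => nbd; apply: Cv; apply: interP nbd.
    by case: Cu => _ _; apply; rewrite adj_sym.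
apply: atmost_count => v.
  case=> /main [_]; first by move=> [|[]]; [left|right].
  by move=> [|[]]; [right|left].
move=> [/main[Cv b1] /main[Bv b2]]; split.
  case: b1 => [//|[_ Bv']]; apply: contrapT => nbd; apply: Bv; exact: interP.
case: b2 => [//|[_ Cv']]; apply: contrapT => nbd; apply: Cv; exact: interP.
Qed.

(** * Separations of least order around a given set *)

Section Tight.
Variables (S Z : set G) (l : nat).
Let F := [set B | Z `<=` B /\ atmost l (bd S B)].
Hypothesis lmin : forall B i, Z `<=` B -> atmost i (bd S B) -> l <= i.

(** Both orders are at least [l] by minimality, and their sum is at most twice [l]. *)
Lemma tight_setIU B C : F B -> F C -> F (B `&` C) /\ F (B `|` C).
Proof.
move=> [ZB Bl] [ZC Cl]; have [i [j [ij Bi Bj]]] := bd_setIU Bl Cl.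
have li : l <= i by apply: lmin Bi => v Zv; split; [exact: ZB|exact: ZC].
have lj : l <= j by apply: lmin Bj => v /ZB; left.
split; split.
- by move=> v Zv; split; [exact: ZB|exact: ZC].
- apply: atmost_leq Bi; rewrite -(leq_add2r l); apply: leq_trans ij.
  by rewrite leq_add2l.
- by move=> v /ZB; left.
- apply: atmost_leq Bj; rewrite -(leq_add2l l); apply: leq_trans ij.
  by rewrite leq_add2r.
Qed.

(** Otherwise [l.+1] boundary vertices of the union lie in finitely many members, whose union is
    tight and has all of them in its boundary. *)
Lemma tight_bigcup : F !=set0 -> F (\bigcup_(B in F) B).
Proof.
move=> [B0 FB0]; split; first by move=> v Zv; exists B0 => //; case: FB0 => + _; exact.
apply: contrapT => /atmostPn[s [Us sl sbd]].
have [B FB sB] : exists2 B, F B & [set` s] `<=` B.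
  elim: s sbd {Us sl} => [|x s IHs] sbd; first by exists B0.
  have [|B FB sB] := IHs; first by move=> v /= vs; apply: sbd => /=; rewrite inE vs orbT.
  have [[C FC Cx] _] := sbd x (mem_head _ _).
  exists (B `|` C); first by have [] := tight_setIU FB FC.
  by move=> v /=; rewrite inE => /orP[/eqP->|/sB]; [right|left].
have := atmost_uniq FB.2 Us _; rewrite sl ltnn => /(_ _)/notF; apply => v vs.
have [_ vbd] := sbd _ vs; split; first exact: sB.
case: vbd => [Sv|[u vu nu]]; [by left|right; exists u => // Bu].
by apply: nu; exists B.
Qed.

(** Each of [l.+1] boundary vertices outside [S] has a neighbour missed by some member; the
    intersection of finitely many members keeps all these witnesses. *)
Lemma tight_bigcap : F !=set0 -> F (\bigcap_(B in F) B).
Proof.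
move=> [B0 FB0]; split; first by move=> v Zv B [+ _]; exact.
apply: contrapT => /atmostPn[s [Us sl sbd]].
have [B FB sB] : exists2 B, F B &
    forall v, v \in s -> S v \/ exists2 u, adj v u & ~ B u.
  elim: s sbd {Us sl} => [|x s IHs] sbd; first by exists B0.
  have [|B FB sB] := IHs; first by move=> v /= vs; apply: sbd => /=; rewrite inE vs orbT.
  have [_ xbd] := sbd x (mem_head _ _).
  have [C FC xC] : exists2 C, F C & S x \/ exists2 u, adj x u & ~ C u.
    case: xbd => [Sx|[u xu /existsNP[C /not_implyP[FC Cu]]]].
      by exists B0 => //; left.
    by exists C => //; right; exists u.
  exists (B `&` C); first by have [] := tight_setIU FB FC.
  move=> v; rewrite inE => /orP[/eqP->|/sB].
    by case: xC => [|[u xu Cu]]; [left|right; exists u => // -[]].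
  by case=> [|[u xu Bu]]; [left|right; exists u => // -[]].
have := atmost_uniq FB.2 Us _; rewrite sl ltnn => /(_ _)/notF; apply => v vs.
by split; [have [+ _] := sbd _ vs; exact|exact: sB].
Qed.

End Tight.
End Boundary.

(** * Linked sets and inseparable sets *)

Section Uniform.
Variables (G : sgraph) (K : Type) (k : nat).
Hypothesis infK : infinite_set [set: K].
Implicit Types (S D X Y B : set G).

(* With the vertices of [D] deleted, no separation of order less than [k - #|D|] has [S] on one
   side and more vertices of [X] on the other than its order. *)
Definition uniform S D X := forall B l, D `<=` B -> l < k ->
  atmost l (bd (S `|` D) B) -> atmost l ((X `|` D) `&` B).

(* With the vertices of [D] deleted, [X] is [(k - #|D|)]-connected, in terms of separations. *)
Definition inseparable D X := forall B l, D `<=` B -> l < k -> atmost l (bd D B) ->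
  atmost l ((X `|` D) `&` B) \/ atmost l ((X `|` D) `\` inter D B).

Lemma uniform_sub S D X Y : X `<=` Y -> uniform S D Y -> uniform S D X.
Proof.
move=> XY uY B l DB lk Bl; apply: atmost_sub (uY _ _ DB lk Bl).
by apply: setSI; exact: setSU.
Qed.

Lemma inseparable_sub D X Y : X `<=` Y -> inseparable D Y -> inseparable D X.
Proof.
move=> XY iY B l DB lk Bl.
have [h|h] := iY _ _ DB lk Bl; [left|right]; apply: atmost_sub h.
  by apply: setSI; exact: setSU.
by apply: setSD; exact: setSU.
Qed.

(** [Y] is a maximal uniform subset of [X]. A vertex [x] that cannot be added lies in a set [B] of
    some order [l] that already contains [l] vertices [s] of [Y] and [D]; so [B] is tight for [s],
    and the union of all sets tight for [s] contains [x]. *)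
Lemma uniform_cover S D X : exists2 Y, Y `<=` X & uniform S D Y /\
  exists cl : seq G -> set G, forall x, X x -> ~ Y x -> exists s,
    [/\ (forall z, z \in s -> (Y `|` D) z), size s < k, D `<=` cl s,
        atmost k.-1 (bd (S `|` D) (cl s)) & cl s x].
Proof.
pose P := [set Y | Y `<=` X /\ uniform S D Y].
have [||Y [YX uY] [_ Ymax]] := @Zorn_above _ P set0.
- split=> // B l DB lk Bl; apply: atmost_sub Bl => v [[//|Dv] Bv].
  by split=> //; left; right.
- move=> F FP [Y0 FY0] Ftot; split=> [x [Y FY Yx]|B l DB lk Bl].
    by have [+ _] := FP _ FY; exact.
  apply: contrapT => /atmostPn[s [Us sl sX]].
  have [Y FY sY] : exists2 Y, F Y & forall x, x \in s -> (Y `|` D) x.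
    elim: s sX {Us sl} => [|x s IHs] sX; first by exists Y0.
    have [|Y FY sY] := IHs; first by move=> v /= vs; apply: sX => /=; rewrite inE vs orbT.
    have [[[Z FZ Zx]|Dx] Bx] := sX x (mem_head _ _); last first.
      by exists Y => // v; rewrite inE => /orP[/eqP->|/sY//]; right.
    have [YZ|ZY] := Ftot _ _ FY FZ.
      exists Z => // v; rewrite inE => /orP[/eqP->|/sY [/YZ|]]; by [left|right].
    by exists Y => // v; rewrite inE => /orP[/eqP->|/sY//]; left; exact: ZY.
  have [_ /(_ _ _ DB lk Bl) Yl] := FP _ FY.
  have := atmost_uniq Yl Us _; rewrite sl ltnn => /(_ _)/notF; apply => v vs.
  by split; [exact: sY|have [] := sX _ vs].
exists Y => //; split=> //.
pose cl (s : seq G) := \bigcup_(B in [set B | [set` s] `|` D `<=` B /\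
  atmost (size s) (bd (S `|` D) B)]) B.
exists cl => x Xx nYx.
have : ~ P (x |` Y).
  by move=> /Ymax => /(_ (@subsetUr _ _ _))/(_ x (or_introl erefl)).
move=> /not_andP[]; first by move=> nX; exfalso; apply: nX => y [->|/YX].
move=> /existsNP[B /existsNP[l /not_implyP[DB /not_implyP[lk /not_implyP[Bl nl]]]]].
have Yl := uY _ _ DB lk Bl; have [s [Us sl sE]] := atmost_exact Yl.
have sY z : z \in s -> ((Y `|` D) `&` B) z by rewrite sE.
have xB : B x.
  apply: contrapT => Bx; apply: nl; apply: atmost_sub Yl => v [[[->//|Yv]|Dv] Bv].
    by split=> //; left.
  by split=> //; right.
(* With fewer than [l] vertices in [s], adding [x] would not violate the bound. *)
have sl' : size s = l.
  apply/eqP; rewrite eqn_leq sl leqNgt; apply/negP => ls; apply: nl.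
  exists (x :: s) => // v [[[->|Yv]|Dv] Bv] /=; rewrite inE ?eqxx//; apply/orP; right.
    by have : ((Y `|` D) `&` B) v by [split=> //; left]; rewrite sE.
  by have : ((Y `|` D) `&` B) v by [split=> //; right]; rewrite sE.
have lmin C i : [set` s] `|` D `<=` C -> atmost i (bd (S `|` D) C) -> size s <= i.
  move=> sC Ci; rewrite leqNgt; apply/negP => si.
  have := uY C i (fun v Dv => sC v (or_intror Dv)) (ltn_trans si _) Ci.
  rewrite sl' => /(_ lk)/atmost_uniq-/(_ s Us); rewrite leqNgt si => /(_ _)/notF; apply.
  by move=> v vs; split; [have [] := sY _ vs|apply: sC; left].
have [|Zcl cls] := tight_bigcup lmin.
  exists B; rewrite sl'; split=> // v [/sY[]//|/DB//].
exists s; split.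
- by move=> z /sY[].
- by rewrite sl'.
- by move=> v Dv; apply: Zcl; right.
- by apply: atmost_leq cls; rewrite sl'; case: (k) lk.
- by exists B => //; split; [move=> v [/sY[]//|/DB//]|rewrite sl'].
Qed.

Lemma small_list (s : seq G) (F : G -> set G) :
  (forall x, x \in s -> small K (F x)) ->
  small K [set v | exists2 x, x \in s & F x v].
Proof.
elim: s => [_|x s IHs sF].
  by rewrite (_ : [set _ | _] = set0); [exact: small_finite|apply/seteqP; split=> // v []].
apply: (@small_sub _ _ _ (F x `|` [set v | exists2 x, x \in s & F x v])).
  move=> v [y]; rewrite inE => /orP[/eqP->|ys Fv]; [by left|right].
  by exists y.
apply: small_setU => //; first exact/sF/mem_head.
by apply: IHs => y ys; apply: sF; rewrite inE ys orbT.
Qed.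

(** By uniformity for [D], each covering set contains fewer than [k] vertices of [X]. If the maximal
    [Y] for [D'] were small, these finite pieces would make [X] small. *)
Lemma uniform_shrink S D D' X : D `<=` D' -> finite_set D' -> k > 0 ->
  uniform S D X -> ~ small K X ->
  exists2 Y, Y `<=` X & uniform S D' Y /\ ~ small K Y.
Proof.
move=> DD' finD' k0 uX bX; have [Y YX [uY [cl clP]]] := uniform_cover S D' X.
exists Y => //; split=> // sY; apply: bX.
pose good s := D' `<=` cl s /\ atmost k.-1 (bd (S `|` D') (cl s)).
pose F s := if `[<good s>] then cl s `&` X else set0.
have finF s : finite_set (F s).
  rewrite /F; case: asboolP => // -[D'cl clk]; apply: (@atmost_finite _ k.-1).
  have k1 : k.-1 < k by rewrite prednK.
  apply: (atmost_sub _ (uX (cl s) k.-1 _ k1 _)); last 1 first.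
  - by apply: atmost_sub clk; apply: bd_subS; exact: setUS.
  - by move=> v [clv Xv]; split=> //; left.
  - exact: subset_trans D'cl.
have sYD : small K (Y `|` D') by apply: small_setU => //; exact: small_finite.
apply: (small_sub _ (small_setU infK sY (small_bigcup_seq (n := k) infK sYD finF))) => x Xx.
have [Yx|nYx] := pselect (Y x); [by left|right].
have [s [sY' sk D'cl clk clx]] := clP _ Xx nYx.
by exists s => //; rewrite /F asboolT.
Qed.

(** Otherwise [D] with the component of [x] has its boundary inside [D] but contains [x] in addition
    to all of [D]. *)
Lemma uniform_reach (S D : seq G) X x : uniq D -> size D < k ->
  uniform [set` S] [set` D] X -> X x -> x \notin D ->
  exists2 s, s \in S & reach [set` D] s x.
Proof.
move=> UD Dk uX Xx xD; apply: contrapT => nS.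
pose B := [set` D] `|` [set v | reach [set` D] x v].
have BD : bd ([set` S] `|` [set` D]) B `<=` [set` D].
  move=> v [[//|xv] [[Sv|//]|[u vu /not_orP[Du xu]]]].
    by exfalso; apply: nS; exists v => //; exact: reach_sym.
  by exfalso; apply: xu; exact: reach_step vu Du.
have := uX B _ (@subsetUl _ _ _) Dk (atmost_sub BD (atmost_seq D)).
move=> /atmost_uniq-/(_ (x :: D)); rewrite /= xD UD ltnn => /(_ isT)/(_ _)/notF.
apply=> v /=; rewrite inE => /orP[/eqP->|vD].
  by split; [left|right; apply: reach_refl; exact/negP].
by split; [right|left].
Qed.

(* The connected set [W] meets the boundary of a separation unless [S] lies on one side of it. *)
Lemma inseparable_uniform (S D W : seq G) s0 X : uniform [set` S] [set` D] X ->
  (forall x, X x -> reach [set` D] s0 x) ->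
  (forall s, s \in S -> reach [set` D] s0 s -> exists p,
    [/\ path (@adj G) s0 p, last s0 p = s & {subset s0 :: p <= W}]) ->
  (forall w, w \in W -> w \notin D) ->
  (forall w, w \in W -> inseparable (w |` [set` D]) X) ->
  inseparable [set` D] X.
Proof.
move=> uX Xs0 SW WD WX B l DB lk Bl.
have [[w [wW wB]]|noW] := pselect (exists w, w \in W /\ bd [set` D] B w).
  have wDB : w |` [set` D] `<=` B by move=> v [->|/DB//]; exact: bd_sub wB.
  have wbd : bd (w |` [set` D]) B `<=` bd [set` D] B.
    by move=> v [Bv [[->//|Dv]|vo]]; split=> //; [left|right].
  have XD : X `|` [set` D] `<=` X `|` (w |` [set` D]) by exact/setUS/subsetUr.
  have [h|h] := WX _ wW _ _ wDB lk (atmost_sub wbd Bl); [left|right].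
    by apply: atmost_sub h; exact: setSI.
  apply: atmost_sub h => v [Xv nBv]; split; first exact: XD.
  by move=> [Bv /not_orP[_ Dv] nB]; apply: nBv.
have [Ws0|Ws0] := pselect (inter [set` D] B s0).
  right.
  have SB s : s \in S -> reach [set` D] s0 s -> inter [set` D] B s.
    move=> sS s0s; have [p [+ <- pW]] := SW _ sS s0s.
    elim/last_ind: p pW => // p z IHp pW; rewrite rcons_path last_rcons => /andP[pp pz].
    have [|_ _ nB] := IHp _ pp.
      by move=> t tp; apply: pW; rewrite -rcons_cons mem_rcons inE tp orbT.
    have zW : z \in W by apply: pW; rewrite -rcons_cons mem_rcons mem_head.
    by apply: interP; [exact: nB|move=> zb; apply: noW; exists z].
  (* The paths in [W] keep the reachable vertices of [S] inside the interior of [B], so uniformity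
     can be applied to the far side of [B] within the component of [s0]. *)
  pose C := [set` D] `|` ([set v | reach [set` D] s0 v] `\` inter [set` D] B).
  have CD : bd ([set` S] `|` [set` D]) C `<=` bd [set` D] B.
    move=> v [[Dv _|[s0v nv]]]; first by split; [exact: DB|left].
    have [_ nDv] := reach_out s0v.
    case=> [[Sv|//]|[u vu /not_orP[Du /not_andP[s0u|/contrapT iu]]]].
    - by exfalso; apply: nv; exact: SB.
    - by exfalso; apply: s0u; exact: reach_step vu Du.
    - apply: contrapT => nb; apply: nv; apply: interP nb.
      by case: iu => _ _; apply; rewrite adj_sym.
  apply: atmost_sub (uX C l (@subsetUl _ _ _) lk (atmost_sub CD Bl)) => v [XDv nv].
  split=> //; case: XDv => [Xv|Dv]; [right|by left].
  by split=> //; exact: Xs0.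
left.
have SB s : s \in S -> reach [set` D] s0 s -> ~ B s.
  move=> sS s0s; have [p [+ <- pW]] := SW _ sS s0s.
  have nbW w : w \in W -> B w -> inter [set` D] B w.
    by move=> wW Bw; apply: interP => // wb; apply: noW; exists w.
  have Bs0 : ~ B s0 by move=> /(nbW _ (pW _ (mem_head _ _))).
  elim/last_ind: p pW => // p z IHp pW; rewrite rcons_path last_rcons => /andP[pp pz].
  have zW : z \in W by apply: pW; rewrite -rcons_cons mem_rcons mem_head.
  move=> /(nbW _ zW)[_ _ nB]; apply: IHp pp _; last by apply: nB; rewrite adj_sym.
  by move=> t tp; apply: pW; rewrite -rcons_cons mem_rcons inE tp orbT.
(* Now the reachable vertices of [S] lie outside [B], and uniformity is applied to [B] within the
   component. *)
pose C := [set` D] `|` ([set v | reach [set` D] s0 v] `&` B).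
have CD : bd ([set` S] `|` [set` D]) C `<=` bd [set` D] B.
  move=> v [[Dv _|[s0v Bv]]]; first by split; [exact: DB|left].
  have [_ nDv] := reach_out s0v.
  case=> [[Sv|//]|[u vu /not_orP[Du /not_andP[s0u|Bu]]]].
  - by case: (SB _ Sv s0v).
  - by exfalso; apply: s0u; exact: reach_step vu Du.
  - by split=> //; right; exists u.
apply: atmost_sub (uX C l (@subsetUl _ _ _) lk (atmost_sub CD Bl)) => v [XDv Bv].
split=> //; case: XDv => [Xv|Dv]; [right|by left].
by split=> //; exact: Xs0.
Qed.

(* A separation splitting [X] but not contradicting uniformity has a vertex of a finite set [W] in
   its boundary: recurse on the deletion of each vertex of [W]. *)
Theorem uniform_inseparable (S D : seq G) X : uniq D -> size D <= k ->
  uniform [set` S] [set` D] X -> ~ small K X ->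
  exists2 X', X' `<=` X & ~ small K X' /\ inseparable [set` D] X'.
Proof.
move=> UD; move j : (k - size D) => n; elim: n D UD j X => [|n IHn] D UD Dn X Dk uX bX.
  (* Here [D] has [k] vertices, all in the boundary of every [B] containing it, so no order below
     [k] occurs. *)
  exists X => //; split=> // B l DB lk Bl; exfalso.
  have := atmost_uniq Bl UD _; rewrite leqNgt (leq_trans lk) -?subn_eq0 ?Dn// => /(_ _)/notF.
  by apply=> v Dv; split; [exact: DB|left].
have {}Dk : size D < k by rewrite -subn_gt0 Dn.
have k0 : 0 < k by exact: leq_ltn_trans Dk.
have [s0 s0S bX0] : exists2 s, s \in S & ~ small K (X `&` [set v | reach [set` D] s v]).
  apply: contrapT => nS; apply: bX.
  have sS : small K [set v | exists2 s, s \in S & (X `&` [set v | reach [set` D] s v]) v].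
    by apply: small_list => s sS; apply: contrapT => ns; apply: nS; exists s.
  apply: (small_sub _ (small_setU infK (small_finite infK (finite_seq D)) sS)) => x Xx.
  have [xD|xD] := boolP (x \in D); [by left|right].
  by have [s sS' sx] := uniform_reach UD Dk uX Xx xD; exists s.
have /choice[P PP] s : exists p, reach [set` D] s0 s ->
    [/\ path (@adj G) s0 p, last s0 p = s & forall z, z \in s0 :: p -> ~ [set` D] z].
  by have [[p pP]|ns] := pselect (reach [set` D] s0 s); [exists p|exists [::]].
pose W := flatten [seq s0 :: P s | s <- S & `[<reach [set` D] s0 s>]].
have WD w : w \in W -> w \notin D.
  move=> /flattenP[_ /mapP[s + ->]]; rewrite mem_filter => /andP[/asboolP/PP[_ _ sD] _].
  by move=> /sD/negP.
have SW s : s \in S -> reach [set` D] s0 s -> exists p,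
    [/\ path (@adj G) s0 p, last s0 p = s & {subset s0 :: p <= W}].
  move=> sS s0s; have [pp pl _] := PP _ s0s; exists (P s); split=> // w ws.
  apply/flattenP; exists (s0 :: P s) => //; apply: map_f.
  by rewrite mem_filter sS andbT; exact/asboolP.
have [X' X'X [bX' WX']] : exists2 X', X' `<=` X `&` [set v | reach [set` D] s0 v] &
    ~ small K X' /\ forall w, w \in W -> inseparable (w |` [set` D]) X'.
  elim: W WD {SW} => [|w W IHW] WD; first by exists (X `&` [set v | reach [set` D] s0 v]).
  have [|Y YX [bY YW]] := IHW; first by move=> v vW; apply: WD; rewrite inE vW orbT.
  have wDE : w |` [set` D] = [set` w :: D].
    apply/seteqP; split=> v /=; rewrite inE.
      by case=> ->; rewrite ?eqxx ?orbT.
    by case/orP=> [/eqP|]; [left|right].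
  have uY : uniform [set` S] [set` D] Y.
    by apply: uniform_sub uX => v /YX[].
  have [|Z ZY [uZ bZ]] := uniform_shrink (@subsetUr _ [set w] _) _ k0 uY bY.
    by rewrite wDE; exact: finite_seq.
  rewrite wDE in uZ.
  have wD : w \notin D by apply: WD; exact: mem_head.
  have [|||X' X'Z [bX' iX']] := IHn (w :: D) _ _ Z _ uZ bZ.
  - by rewrite /= wD.
  - by rewrite /= subnS Dn.
  - by [].
  exists X'; first by move=> v /X'Z/ZY/YX.
  split=> // v; rewrite inE => /orP[/eqP->|vW]; first by rewrite wDE.
  by apply: inseparable_sub (YW _ vW) => u /X'Z/ZY.
exists X'; first by move=> v /X'X[].
split=> //; apply: inseparable_uniform SW WD WX'; last by move=> x /X'X[].
by apply: uniform_sub uX => v /X'X[].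
Qed.

End Uniform.

(** * Uncrossing *)

Section Uncross.
Variables (G : sgraph) (S : set G) (k : nat).
Implicit Types (B C : set G) (F : nat -> set G).

(** One set lies in the far side of the other. Then the interiors are disjoint and no edge joins
    them, while the boundaries may overlap. *)
Definition noncrossing B C :=
  (forall v, B v -> ~ inter S C v) \/ (forall v, C v -> ~ inter S B v).

Lemma noncrossing_sub B B' C C' : B' `<=` B -> C' `<=` C ->
  noncrossing B C -> noncrossing B' C'.
Proof.
move=> BB CC [h|h]; [left=> v /BB Bv|right=> v /CC Cv].
  by move=> /(inter_mono CC); exact: h.
by move=> /(inter_mono BB); exact: h.
Qed.

(** One of the two corners has order at most [k] and replaces its set. Only boundary vertices of the
    new set leave the union of the interiors, and since sets only shrink, pairs already resolved
    stay noncrossing. *)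
Lemma uncross_step B n F : atmost k (bd S B) -> (forall i, i < n -> atmost k (bd S (F i))) ->
  exists B' F', [/\ B' `<=` B /\ (forall i, F' i `<=` F i),
    atmost k (bd S B') /\ (forall i, i < n -> atmost k (bd S (F' i))),
    forall i, i < n -> noncrossing B' (F' i) &
    finite_set [set v | (inter S B v \/ exists2 i, i < n & inter S (F i) v) /\
      ~ (inter S B' v \/ exists2 i, i < n & inter S (F' i) v)]].
Proof.
move=> Bk Fk.
suff /(_ n (leqnn n))[B' [F' [h1 h2 h3 h4]]] : forall m, m <= n ->
  exists B' F', [/\ B' `<=` B /\ (forall i, F' i `<=` F i),
    atmost k (bd S B') /\ (forall i, i < n -> atmost k (bd S (F' i))),
    forall i, i < m -> noncrossing B' (F' i) &
    finite_set [set v | (inter S B v \/ exists2 i, i < n & inter S (F i) v) /\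
      ~ (inter S B' v \/ exists2 i, i < n & inter S (F' i) v)]].
  by exists B', F'.
elim=> [|m IHm] mn.
  exists B, F; split=> //; first by split=> [v|i v].
  by apply: (@sub_finite_set _ _ set0) => // v [].
have [B' [F' [[B'B F'F] [B'k F'k] dis fin]]] := IHm (ltnW mn).
have [i [j [ij Bi Fj]]] := bd_setD B'k (F'k _ mn).
have [ik|ki] := leqP i k.
  exists (B' `\` inter S (F' m)), F'; split.
  - by split=> // v [/B'B].
  - by split=> //; exact: atmost_leq Bi.
  - move=> t; rewrite ltnS leq_eqVlt => /orP[/eqP->|/dis]; first by left=> v [].
    by apply: noncrossing_sub => // v [].
  - apply: (@sub_finite_set _ _ (_ `|` _)); last first.
      by rewrite finite_setU; split; [exact: fin|exact: atmost_finite Bi].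
    move=> v [Uv nv]; have [B'v|nB'v] := pselect (inter S B' v); last first.
      left; split=> // -[//|[t tn Ft]]; apply: nv; right; by exists t.
    have nF : ~ inter S (F' m) v by move=> Fv; apply: nv; right; exists m.
    right; apply: contrapT => nb; apply: nv; left; apply: interP nb.
    by split=> //; exact: inter_sub B'v.
have jk : j <= k.
  by rewrite -(leq_add2l k); apply: leq_trans ij; rewrite leq_add2r ltnW.
pose F'' t := if t == m then F' m `\` inter S B' else F' t.
have F''F' t : F'' t `<=` F' t by rewrite /F'' => v; case: eqP => [->|_] => [[]|].
exists B', F''; split.
- by split=> // t v /F''F'/F'F.
- split=> // t tn; rewrite /F''; case: eqP => _; last exact: F'k.
  exact: atmost_leq Fj.
- move=> t; rewrite ltnS leq_eqVlt => /orP[/eqP->|/dis].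
    by right=> v; rewrite /F'' eqxx => -[].
  exact: noncrossing_sub.
- apply: (@sub_finite_set _ _ (_ `|` _)); last first.
    by rewrite finite_setU; split; [exact: fin|exact: atmost_finite Fj].
  move=> v [Uv nv]; have [Fv|nFv] := pselect (inter S (F' m) v); last first.
    left; split=> // -[Bv|[t tn Ft]]; apply: nv; [by left|right; exists t => //].
    by rewrite /F''; case: eqP => // tm; case: nFv; rewrite -tm.
  have nB : ~ inter S B' v by move=> Bv; apply: nv; left.
  right; apply: contrapT => nb; apply: nv; right; exists m => //.
  rewrite /F'' eqxx; apply: interP nb; split=> //; exact: inter_sub Fv.
Qed.

Lemma uncross n F : (forall i, i < n -> atmost k (bd S (F i))) ->
  exists F', [/\ forall i, i < n -> atmost k (bd S (F' i)),
    forall i j, i < n -> j < n -> i <> j -> noncrossing (F' i) (F' j) &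
    finite_set [set v | (exists2 i, i < n & inter S (F i) v) /\
      ~ exists2 i, i < n & inter S (F' i) v]].
Proof.
elim: n => [|n IHn] Fk.
  exists F; split=> //.
  by apply: (@sub_finite_set _ _ set0) => // v [].
have [|F1 [F1k dis1 fin1]] := IHn; first by move=> i /ltnW; exact: Fk.
have [B [F2 [[BF F21] [Bk F2k] dis2 fin2]]] := uncross_step (Fk n (ltnSn n)) F1k.
pose F' i := if i == n then B else F2 i.
have F'n : F' n = B by rewrite /F' eqxx.
have F'lt i : i < n -> F' i = F2 i by move=> ni; rewrite /F' (ltn_eqF ni).
exists F'; split.
- move=> i; rewrite ltnS leq_eqVlt => /orP[/eqP->|ni]; first by rewrite F'n.
  by rewrite F'lt//; exact: F2k.
- move=> i j; rewrite !ltnS leq_eqVlt => /orP[/eqP->|ni].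
    rewrite leq_eqVlt => /orP[/eqP->//|nj] _.
    by rewrite F'n F'lt//; exact: dis2.
  rewrite leq_eqVlt => /orP[/eqP->|nj] ij.
    by rewrite F'n F'lt//; have [h|h] := dis2 _ ni; [right|left].
  by rewrite !F'lt//; apply: noncrossing_sub (dis1 _ _ ni nj ij).
- apply: (@sub_finite_set _ _ (_ `|` _)); last first.
    by rewrite finite_setU; split; [exact: fin1|exact: fin2].
  move=> v [[i]]; rewrite ltnS leq_eqVlt => iN Fv nv.
  have nB : ~ (inter S B v \/ exists2 i, i < n & inter S (F2 i) v).
    case=> [Bv|[t tn F2v]]; apply: nv; first by exists n => //; rewrite F'n.
    by exists t; [exact: ltnW|rewrite F'lt].
  case/orP: iN => [/eqP iE|ni]; first by right; split=> //; left; rewrite -iE.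
  have [[t tn F1v]|nF1] := pselect (exists2 i, i < n & inter S (F1 i) v).
    by right; split=> //; right; exists t.
  by left; split=> //; exists i.
Qed.

End Uncross.

(** * Nearest separations of hubs *)

Section Hubs.
Variables (G : sgraph) (S : set G) (k : nat).
Hypothesis k0 : k > 0.
Implicit Types (B C : set G) (y z : seq G).

(** The separations ignore [S]; those with [S] forced into the far side are covered because
    [bd set0 B] is contained in [bd S B]. *)
Definition hub y := forall B, atmost k.-1 (bd set0 B) ->
  [set` y] `<=` B \/ (forall v, v \in y -> ~ inter set0 B v).

Lemma nearest_separation y : (exists2 B, [set` y] `<=` B & atmost k.-1 (bd S B)) ->
  exists B l, [/\ [set` y] `<=` B, l <= k.-1, atmost l (bd S B),
    forall C i, [set` y] `<=` C -> atmost i (bd S C) -> l <= i &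
    forall C, [set` y] `<=` C -> atmost l (bd S C) -> B `<=` C].
Proof.
move=> [B0 yB0 B0k].
pose P l := `[<exists2 B, [set` y] `<=` B & atmost l (bd S B)>].
have exP : exists l, P l by exists k.-1; apply/asboolP; exists B0.
case: (ex_minnP exP) => l /asboolP[B yB Bl] lmin.
have {}lmin C i : [set` y] `<=` C -> atmost i (bd S C) -> l <= i.
  by move=> yC Ci; apply: lmin; apply/asboolP; exists C.
have [|yI Il] := tight_bigcap lmin; first by exists B.
exists (\bigcap_(C in [set C | [set` y] `<=` C /\ atmost l (bd S C)]) C), l.
split=> //; first exact: lmin yB0 B0k.
by move=> C yC Cl v; apply; split.
Qed.

Variables (near : seq G -> set G) (ord : seq G -> nat).

Definition sep_hub y := hub y /\ [/\ [set` y] `<=` near y, ord y <= k.-1,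
  atmost (ord y) (bd S (near y)),
  forall C i, [set` y] `<=` C -> atmost i (bd S C) -> ord y <= i &
  forall C, [set` y] `<=` C -> atmost (ord y) (bd S C) -> near y `<=` C].

(** If [y] lies in [near z], the union contains [z] and has order at least [ord z]; so the
    intersection has order at most [ord y], contains [y], and hence contains [near y]. The case with
    [y] and [z] exchanged is alike. If neither holds, both hubs lie on the far sides, and the same
    count applies to the opposite corners. *)
Lemma sep_hub_nested y z : sep_hub y -> sep_hub z ->
  [\/ near y `<=` near z, near z `<=` near y |
      forall v, near y v -> ~ inter S (near z) v].
Proof.
move=> [hy [yB yk yl ymin ynear]] [hz [zC zk zl zmin znear]].
have hubS u B t : hub u -> t <= k.-1 -> atmost t (bd S B) ->
    [set` u] `<=` B \/ (forall v, v \in u -> ~ inter S B v).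
  move=> hu tk Bt; have [||h] := hu B; [|by left|].
    exact: atmost_leq tk (atmost_sub (bd_subS (@sub0set _ S)) Bt).
  by right=> v /h nv [Bv _ nB]; apply: nv; split.
have [yC|yC] := hubS _ _ _ hy zk zl.
  apply: Or31; have [i [j [ij Bi Bj]]] := bd_setIU yl zl.
  have li : ord z <= j by apply: zmin Bj => v /zC; right.
  have il : i <= ord y.
    by rewrite -(leq_add2r (ord z)); apply: leq_trans ij; rewrite leq_add2l.
  by move=> v /(ynear _ _ (atmost_leq il Bi))[] // w wy; split; [exact: yB|exact: yC].
have [zB|zB] := hubS _ _ _ hz yk yl.
  apply: Or32; have [i [j [ij Bi Bj]]] := bd_setIU yl zl.
  have li : ord y <= j by apply: ymin Bj => v /yB; left.
  have il : i <= ord z.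
    by rewrite -(leq_add2l (ord y)); apply: leq_trans ij; rewrite addnC leq_add2l.
  by move=> v /(znear _ _ (atmost_leq il Bi))[] // w wz; split; [exact: zB|exact: zC].
apply: Or33; have [i [j [ij Bi Bj]]] := bd_setD yl zl.
have li : ord z <= j by apply: zmin Bj => v zv; split; [exact: zC|exact: zB].
have il : i <= ord y.
  by rewrite -(leq_add2r (ord z)); apply: leq_trans ij; rewrite leq_add2l.
move=> v /(ynear _ _ (atmost_leq il Bi))[] // w wy; split; [exact: yB|exact: yC].
Qed.

End Hubs.

(** * Separating bags *)

Section Bags.
Variables (G : sgraph) (K : Type) (k : nat).
Hypothesis infK : infinite_set [set: K].
Hypothesis k0 : k > 0.

Definition attach (Y : set G) v := [set p | Y p /\ exists2 u, reach Y v u & adj u p].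

Definition separating_bag (Y : set G) := forall v, ~ Y v -> atmost k.-1 (attach Y v).

(** The bag is the complement of the interiors of the uncrossed sets. No edge joins two of these
    interiors, so a component outside the bag stays in one of them and attaches to the boundary of
    that set. *)
Lemma finite_separating_bag (S : seq G) (Y : set G) (ss : seq (seq G)) (cl : seq G -> set G) :
  finite_set Y -> (forall s, s \in ss -> atmost k.-1 (bd [set` S] (cl s))) ->
  (forall v, ~ Y v -> exists2 s, s \in ss & cl s v) ->
  exists Z, [/\ [set` S] `<=` Z, finite_set Z & separating_bag Z].
Proof.
move=> finY clk Ycl.
have Fk i : i < size ss -> atmost k.-1 (bd [set` S] (cl (nth [::] ss i))).
  by move=> ni; apply: clk; exact: mem_nth.
have [F [{}Fk' Fdis Ffin]] := uncross Fk.
set U := [set v | exists2 i, i < size ss & inter [set` S] (F i) v].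
exists (~` U); split.
- by move=> v Sv [i _ [_]].
- have finbd : finite_set (\bigcup_(i in `I_(size ss)) bd [set` S] (cl (nth [::] ss i))).
    apply: bigcup_finite => [|i ni]; first exact: finite_II.
    exact: atmost_finite (Fk _ ni).
  apply: (@sub_finite_set _ _ (Y `|` (_ `|` _))); last first.
    by rewrite !finite_setU; split; [exact: finY|split; [exact: finbd|exact: Ffin]].
  move=> v nU; have [Yv|nYv] := pselect (Y v); [by left|right].
  have [s sss clv] := Ycl _ nYv.
  have ni : index s ss < size ss by rewrite index_mem.
  have [bv|nbv] := pselect (bd [set` S] (cl s) v).
    by left; exists (index s ss) => //; rewrite nth_index.
  right; split=> //; exists (index s ss) => //; rewrite nth_index//.
  exact: interP nbv.
move=> v /contrapT[i ni Fv].
have reachF u : reach (~` U) v u -> inter [set` S] (F i) u.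
  move: u; apply: reach_ind => // y z _ Fy yz /contrapT[j nj Fz].
  have [->//|/eqP ij] := eqVneq i j.
  have Fiz : F i z by case: Fy => _ _; exact.
  have Fjy : F j y by case: Fz => _ _; apply; rewrite adj_sym.
  by have [h|h] := Fdis _ _ ni nj ij; [case: (h _ Fiz)|case: (h _ Fjy)].
apply: atmost_sub (Fk' _ ni) => p [nUp [u /reachF Fu up]].
apply: contrapT => nb; apply: nUp; exists i => //; apply: interP nb.
by case: Fu => _ _; exact.
Qed.

(** The bag is a closure [M] of [Y] without the interiors of the nearest separations of hubs in [M].
    A component meeting such interiors attaches to the boundary of one nearest set. Any other
    component avoids [M]; if it had [k] attachments, they would form a hub separated from [S], and
    the interior of its nearest separation would contain one of them. *)
Lemma small_separating_bag (S : seq G) (Y : set G) (cl : seq G -> set G) :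
  small K [set: nat] -> small K Y ->
  (forall s, atmost k.-1 (bd [set` S] (cl s))) ->
  (forall v, ~ Y v -> exists2 s, (forall z, z \in s -> Y z) & cl s v) ->
  exists Z, [/\ [set` S] `<=` Z, small K Z & separating_bag Z].
Proof.
move=> sN sY clk Ycl.
pose sepa (y : seq G) := exists2 B, [set` y] `<=` B & atmost k.-1 (bd [set` S] B).
have /choice[near /choice[ord nearP]] (y : seq G) : exists B l, sepa y ->
    [/\ [set` y] `<=` B, l <= k.-1, atmost l (bd [set` S] B),
    forall C i, [set` y] `<=` C -> atmost i (bd [set` S] C) -> l <= i &
    forall C, [set` y] `<=` C -> atmost l (bd [set` S] C) -> B `<=` C].
  have [/nearest_separation[B [l h]]|ns] := pselect (sepa y).
    by exists B, l.
  by exists set0, 0.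
(* The operation returns the boundaries of [cl y], of [near y] if [y] can be separated from [S], and
   of some separation splitting [y] if [y] is not a hub. *)
have /choice[c cP] (y : seq G) : exists t : seq G,
  [/\ bd [set` S] (cl y) `<=` [set` t],
   sepa y -> bd [set` S] (near y) `<=` [set` t] &
   ~ hub k y -> exists B, [/\ bd set0 B `<=` [set` t], ~ [set` y] `<=` B &
     ~ forall v, v \in y -> ~ inter set0 B v]].
  have [t1 _ t1P] := clk y.
  have [t2 t2P] : exists t : seq G, sepa y -> bd [set` S] (near y) `<=` [set` t].
    have [/nearP[_ _ [t _ tP] _ _]|ns] := pselect (sepa y); last by exists [::].
    by exists t.
  have [t3 t3P] : exists t : seq G, ~ hub k y -> exists B, [/\ bd set0 B `<=` [set` t],
      ~ [set` y] `<=` B & ~ forall v, v \in y -> ~ inter set0 B v].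
    have [h|/existsNP[B /not_implyP[[t _ tP] /not_orP[n1 n2]]]] := pselect (hub k y).
      by exists [::].
    by exists t => _; exists B.
  exists (t1 ++ t2 ++ t3); split.
  - by move=> v /t1P /= h; rewrite mem_cat h.
  - by move=> /t2P h v /h /= vt; rewrite !mem_cat vt orbT.
  - move=> /t3P[B [Bt n1 n2]]; exists B; split=> // v /Bt /= vt.
    by rewrite !mem_cat vt !orbT.
have sYS : small K (Y `|` [set` S]).
  by apply: small_setU => //; apply: small_finite => //; exact: finite_seq.
have [M [YSM Mc sM]] := small_closure infK c sN sYS.
have Mcl s v : (forall z, z \in s -> M z) -> bd [set` S] (cl s) v -> M v.
  by move=> sM' bv; apply: (Mc s) => //; have [h _ _] := cP s; exact: h.
have Mnear s v : (forall z, z \in s -> M z) -> sepa s -> bd [set` S] (near s) v -> M v.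
  by move=> sM' ss bv; apply: (Mc s) => //; have [_ /(_ ss) h _] := cP s; exact: h.
pose H y := [/\ uniq y, size y = k, forall z, z \in y -> M z, hub k y & sepa y].
have HS y : H y -> sep_hub [set` S] k near ord y.
  by move=> [_ _ _ hy /nearP].
pose Om := [set v | exists2 y, H y & inter [set` S] (near y) v].
exists (M `\` Om); split.
- move=> v Sv; split; first by apply: YSM; right.
  by move=> [y _ [_]].
- by apply: small_sub sM => v [].
move=> v nv.
have [[u0 vu0 [y0 Hy0 u0y0]]|nOm] := pselect (exists2 u, reach (M `\` Om) v u & Om u).
  have nested y z : H y -> H z -> inter [set` S] (near y) u0 ->
      inter [set` S] (near z) u0 -> near y `<=` near z \/ near z `<=` near y.
    move=> /HS Hy /HS Hz yu zu; case: (sep_hub_nested Hy Hz) => h; [by left|by right|].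
    by case: (h _ (inter_sub yu)).
  (* If the component leaves the interior of [near y], it enters that of some [near z]; by
     nestedness the larger of the two sets has both [u0] and the new vertex in its interior. *)
  have reachD u : reach (M `\` Om) v u ->
      exists2 y, H y & inter [set` S] (near y) u0 /\ inter [set` S] (near y) u.
    move=> vu; have : reach (M `\` Om) u0 u by apply: reach_trans vu; exact: reach_sym.
    move: {vu} u; apply: reach_ind; first by exists y0.
    move=> a b _ [y Hy [yu0 ya]] ab nb.
    have yb : near y b by case: ya => _ _; exact.
    have [yib|nyb] := pselect (inter [set` S] (near y) b).
      by exists y.
    have [z Hz zb] : Om b.
      apply: contrapT => nOb; apply: nyb; apply: (interP yb) => bb.
      apply: nb; split=> //; by have [_ _ yM _ sy] := Hy; apply: Mnear bb.
    have za : near z a by case: zb => _ _; apply; rewrite adj_sym.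
    case: (sep_hub_nested (HS _ Hy) (HS _ Hz)) => h.
    - by exists z => //; split=> //; exact: inter_mono h _ yu0.
    - by exists y => //; split=> //; exact: inter_mono h _ zb.
    - by case: (h _ yb).
  apply: contrapT => /atmostPn[s [Us sk sN']].
  (* The nearest sets with [u0] in their interior form a chain, so one of them contains all [k]
     attachments. *)
  have [y Hy [yu0 sy]] : exists2 y, H y & inter [set` S] (near y) u0 /\
      (forall p, p \in s -> near y p).
    elim: s sN' {Us sk} => [|p s IHs] sN'; first by exists y0.
    have [|y Hy [yu0 sy]] := IHs; first by move=> q /= qs; apply: sN' => /=; rewrite inE qs orbT.
    have [_ [u /reachD[z Hz [zu0 zu]] up]] := sN' p (mem_head _ _).
    have zp : near z p by case: zu => _ _; exact.
    have [yz|zy] := nested _ _ Hy Hz yu0 zu0.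
      exists z => //; split=> // q; rewrite inE => /orP[/eqP->//|/sy]; exact: yz.
    exists y => //; split=> // q; rewrite inE => /orP[/eqP->|/sy//]; exact: zy.
  have [_ [_ yk ybd _ _]] := HS _ Hy.
  have := atmost_uniq (atmost_leq yk ybd) Us _; rewrite sk ltnn => /(_ _)/notF; apply => p ps.
  apply: contrapT => nb; have [[_ +] _] := sN' _ ps; apply; exists y => //.
  by apply: interP nb; exact: sy.
have nM u : reach (M `\` Om) v u -> ~ M u.
  move=> vu Mu; have [_] := reach_out vu; apply; split=> // Ou.
  by apply: nOm; exists u.
have vv : reach (M `\` Om) v v by exact: reach_refl.
apply: contrapT => /atmostPn[y [Uy yk yN]]; rewrite prednK// in yk.
have yM z : z \in y -> M z by move=> /yN[[]].
(* A separation with its boundary in [M] cannot divide a component that avoids [M]. *)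
have side S' B : bd S' B `<=` M -> B v -> forall u, reach (M `\` Om) v u -> inter S' B u.
  move=> BM Bv; have nMB u : B u -> ~ M u -> inter S' B u.
    by move=> Bu Mu; apply: interP => // /BM.
  apply: reach_ind; first by apply: nMB => //; exact: nM.
  move=> a b va [_ _ nB] ab nb; apply: nMB; first exact: nB.
  by apply: nM; exact: reach_step ab nb.
(* Were [y] split, some splitting separation would have its boundary in [M] and the component on one
   side; so would be [y], whose vertices have neighbours in the component. *)
have hy : hub k y.
  apply: contrapT => nh; have [_ _ /(_ nh)[B [Bt n1 n2]]] := cP y.
  have BM : bd set0 B `<=` M by move=> b /Bt bt; exact: Mc bt.
  have [Bv|nBv] := pselect (B v).
    by apply: n1 => z /yN[_ [u /(side _ _ BM Bv)[_ _ nB] uz]]; exact: nB.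
  apply: n2 => z /yN[_ [u vu uz]] [Bz _ nB].
  suff /(_ _ vu) : forall u, reach (M `\` Om) v u -> ~ B u.
    by apply; apply: nB; rewrite adj_sym.
  apply: reach_ind => // a b va Ba ab nb Bb.
  apply: (nM b); first exact: reach_step ab nb.
  by apply: BM; split=> //; right; exists a; rewrite 1?adj_sym.
have nYv : ~ Y v by move=> Yv; apply: (nM v vv); apply: YSM; left.
have [s sY' sv] := Ycl _ nYv.
have sM' z : z \in s -> M z by move=> /sY' Yz; apply: YSM; left.
have sy : sepa y.
  exists (cl s) => // z /yN[_ [u vu uz]].
  have [|_ _ nB] := side [set` S] (cl s) _ sv u vu; last exact: nB.
  by move=> b; exact: Mcl.
have Hy : H y by [].
have [_ [ynear yord ybd _ _]] := HS _ Hy.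
have := atmost_uniq (atmost_leq yord ybd) Uy _.
rewrite yk leqNgt ltn_predL k0 => /(_ _)/notF; apply => z zy.
apply: contrapT => nb; have [[_ +] _] := yN _ zy; apply; exists y => //.
by apply: interP nb; exact: ynear.
Qed.

Theorem separating_bag_exists (S : seq G) :
  (forall X : set G, inseparable k set0 X -> small K X) ->
  exists Z, [/\ [set` S] `<=` Z, small K Z & separating_bag Z].
Proof.
move=> noX; have [Y _ [uY [cl clP]]] := uniform_cover k [set` S] set0 [set: G].
have sY : small K Y.
  apply: contrapT => bY.
  have [|X _ [bX iX]] := @uniform_inseparable G K k infK S [::] Y isT (leq0n k) _ bY.
    by rewrite set_nil.
  by rewrite set_nil in iX; exact: bX (noX _ iX).
(* The bound is known only for the sequences that occur in the covering; the default [set0], with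
   empty boundary, extends it to all. *)
pose cl' s := if `[<atmost k.-1 (bd [set` S] (cl s))>] then cl s else set0.
have cl'k s : atmost k.-1 (bd [set` S] (cl' s)).
  by rewrite /cl'; case: asboolP => // _; exists [::] => // v [].
have Ycl v : ~ Y v -> exists s, [/\ forall z, z \in s -> Y z, size s < k & cl' s v].
  move=> /(clP v I)[s [sY' sk _ clk clv]]; exists s; split=> //.
    by move=> z /sY'[].
  by rewrite /cl' asboolT// -[X in bd X](setU0 [set` S]).
have [sN|nsN] := pselect (small K [set: nat]).
  apply: (small_separating_bag sN sY cl'k) => v /Ycl[s [sY' _ sv]].
  by exists s.
have finY := finite_small nsN sY.
have /finite_seqP[ss ssE] := finite_bounded_seqs k finY.
have ssP s : s \in ss <-> (forall z, z \in s -> Y z) /\ size s < k.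
  have : [set` ss] s = ((forall z, z \in s -> Y z) /\ size s < k) by rewrite -ssE.
  by move=> /= ->.
have [|Z [SZ finZ sepZ]] := @finite_separating_bag S Y ss cl' finY (fun s _ => cl'k s).
  by move=> v /Ycl[s [sY' sk sv]]; exists s => //; apply/ssP.
by exists Z; split=> //; exact: small_finite.
Qed.
End Bags.

(** * Trees of finite sequences *)

Lemma card_le_atmost (T : choiceType) (A : set T) n : A #<= `I_n <-> atmost n A.
Proof.
split=> [AI|[s sn As]].
  have /finite_seqP[s AE] : finite_set A by apply: card_le_finite AI (finite_II n).
  exists (undup s); last by move=> x; rewrite AE /= mem_undup.
  have sI : `I_(size (undup s)) #<= A.
    apply: (@card_le_surj _ _ A _ (fun x i => i = index x (undup s))).
      move=> i /= ni; case: s AE ni => // y s AE ni.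
      exists (nth y (undup (y :: s)) i); last by rewrite index_uniq// undup_uniq.
      by rewrite AE /= -mem_undup mem_nth.
    by move=> x i j -> ->.
  by rewrite -card_le_II; exact: card_le_trans AI.
apply: (@card_le_fun _ _ _ _ (index^~ s)) => [x /As xs|x y /As xs /As ys].
  by apply: leq_trans sn; rewrite /= index_mem.
by move=> e; rewrite -[x](nth_index x xs) e nth_index.
Qed.

Lemma card_uniq_seq (T : choiceType) (s : seq T) : uniq s -> [set` s] #= `I_(size s).
Proof.
move=> Us; apply/card_eqPle; split; first by apply/card_le_atmost; exact: atmost_seq.
case: s Us => [|x s] Us; first by rewrite II0; exact: card_ge0.
apply: (@card_le_fun _ _ _ _ (nth x (x :: s))) => [i|i j]; first exact: mem_nth.
by move=> ni nj /eqP; rewrite nth_uniq// => /eqP.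
Qed.

(** The bound [k.-1] expresses a size below [k] only for positive [k], hence the first conjunct. *)
Lemma card_lt_atmost (T : choiceType) (A : set T) k : card_lt A `I_k <->
  0 < k /\ atmost k.-1 A.
Proof.
split=> [/andP[Ak nAk]|[k0 Ak]].
  have /atmost_exact[s [Us sk AE]] := (card_le_atmost A k).1 Ak.
  have sE := card_uniq_seq Us.
  have sk' : size s < k.
    rewrite ltn_neqAle sk andbT; apply: contra nAk => /eqP <-.
    by rewrite AE.
  split; first exact: leq_ltn_trans sk'.
  by rewrite AE; exists s => //; rewrite -ltnS prednK//; exact: leq_ltn_trans sk'.
have /card_le_atmost Ak1 : atmost k.-1 A := Ak.
apply/andP; split.
  by apply/card_le_atmost; apply: atmost_leq Ak; exact: leq_pred.
apply/negP; rewrite card_eq_le => /andP[_ kA].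
have := card_le_trans kA ((card_le_atmost A k.-1).2 Ak).
by rewrite card_le_II leqNgt ltn_predL k0.
Qed.

Lemma card_lt_small (T K : Type) (A : set T) : card_lt A [set: K] <-> small K A.
Proof.
split=> [/andP[AK nAK] KA|sA].
  by move/negP: nAK; apply; apply/card_eqPle.
apply/andP; split; first by have [//|/sA] := card_le_total A [set: K].
by apply/negP; rewrite card_eq_le => /andP[_ /sA].
Qed.

Section Paths.
Variable G : sgraph.
Implicit Types (U : set G) (x y z b : G).

Lemma reach_is_path U x y : reach U x y ->
  exists2 s, is_path x y s & forall z, z \in s -> ~ U z.
Proof.
move=> [p [+ + pU]]; case/shortenP=> q qp Uq qsub <-.
exists (x :: q); first by exists q.
move=> z; rewrite inE => zq; apply: pU; rewrite inE.
by case/orP: zq => [->//|/qsub->]; rewrite orbT.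
Qed.

Lemma path_exit U x p : path (@adj G) x p -> U x -> ~ U (last x p) ->
  exists u v, [/\ u \in x :: p, v \in x :: p, adj u v, U u & ~ U v].
Proof.
elim: p x => [|y p IHp] x //= /andP[xy yp] Ux nUl.
have [Uy|nUy] := pselect (U y); last first.
  by exists x, y; rewrite mem_head inE mem_head orbT.
have [u [v [us vs uv Uu nUv]]] := IHp _ yp Uy nUl.
by exists u, v; rewrite [u \in _]inE [v \in _]inE us vs !orbT.
Qed.

(** Leaving [U] and returning to it both use the edge between [b] and [b'], so [b] would occur twice
    on the path. *)
Lemma path_cut U b b' x y s :
  (forall u v, adj u v -> U u -> ~ U v -> u = b /\ v = b') ->
  is_path x y s -> U x -> U y -> forall z, z \in s -> U z.
Proof.
move=> cut [p [-> xp Up lp]] Ux Uy z; rewrite inE => /orP[/eqP->//|zp].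
apply: contrapT => nUz.
case/splitPr: p / zp xp Up lp => p1 p2; rewrite cat_path last_cat /=.
case/and3P=> xp1 p1z zp2 Up lp.
have [||u [v [us _ uv Uu nUv]]] := @path_exit U x (rcons p1 z) _ Ux.
- by rewrite rcons_path xp1.
- by rewrite last_rcons.
have [ub _] := cut _ _ uv Uu nUv.
have [|u' [v' [_ vs' uv' nUu' /contrapT Uv']]] := @path_exit (~` U) z p2 zp2 nUz.
  by rewrite lp /=; apply.
have [] := cut v' u' _ Uv' nUu'; first by rewrite adj_sym.
move=> vb' _; move: us vs'; rewrite ub vb' -rcons_cons mem_rcons !inE.
have bz : b != z by apply: contra_notN nUz => /eqP <-; rewrite -ub.
rewrite (negbTE bz) /= => bp1 bp2.
have : uniq ((x :: p1) ++ z :: p2) by [].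
rewrite cat_uniq => /and3P[_ /hasPn/(_ b) + _].
by rewrite inE bp2 orbT /= inE bp1 => /(_ isT).
Qed.

End Paths.

Section SeqTree.
Variable V : choiceType.
Implicit Types (s t u : seq V).

Definition seq_adj : rel (seq V) := fun s t =>
  (s != [::]) && (t == behead s) || (t != [::]) && (s == behead t).

Lemma seq_adj_sym : symmetric seq_adj.
Proof. by move=> s t; rewrite /seq_adj orbC. Qed.

Lemma behead_neq s : s != [::] -> (s == behead s) = false.
Proof.
case: s => // x s _; apply/eqP => /(congr1 size) /= /eqP.
by rewrite eqn_leq ltnn.
Qed.

Lemma seq_adj_irr : irreflexive seq_adj.
Proof. by move=> s; rewrite /seq_adj orbb; case: eqP => //= /eqP /behead_neq. Qed.

Definition seq_tree := SGraph seq_adj_sym seq_adj_irr.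

Lemma seq_adj_behead s t : seq_adj s t -> size t <= size s -> s != [::] /\ t = behead s.
Proof.
case/orP=> /andP[s0 /eqP->] => [//|].
by case: t s0 => //= x t _; rewrite ltnn.
Qed.

(** A longest sequence on a cycle would have both its neighbours there equal to its [behead]. *)
Lemma seq_tree_is_tree : is_tree seq_tree.
Proof.
split; first split.
- exact: inhabits [::].
- have root (s : seq_tree) : reach set0 s ([::] : seq_tree).
    elim: s => [|x s IHs]; first exact: reach_refl.
    apply: reach_trans IHs; apply: (reach_step (reach_refl _)) => //.
    by rewrite /= /seq_adj /= eqxx.
  move=> s t; have [p ptP _] := reach_is_path (reach_trans (root s) (reach_sym (root t))).
  by exists p.
move=> c /andP[cc Uc]; rewrite leqNgt; apply/negP => c3.
have [m mc mmax] : exists2 m : seq_tree, m \in c & forall s, s \in c -> size s <= size m.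
  elim: c {cc Uc} c3 => //= s c IHc _.
  have [/eqP->|c0] := boolP (c == [::]).
    by exists s; rewrite ?mem_head// => t; rewrite inE => /eqP->.
  have [m mc mmax] : exists2 m : seq_tree, m \in c & forall s, s \in c -> size s <= size m.
    case: c c0 {IHc} => // t c _.
    elim: c t => [|r c IHc] t; first by exists t; rewrite ?mem_head// => u; rewrite inE => /eqP->.
    have [m mc mmax] := IHc r.
    have [tm|mt] := leqP (size t) (size m).
      by exists m; [rewrite inE mc orbT|move=> u; rewrite inE => /orP[/eqP->//|/mmax]].
    exists t; first exact: mem_head.
    by move=> u; rewrite inE => /orP[/eqP->//|/mmax um]; apply: leq_trans um (ltnW mt).
  have [sm|ms] := leqP (size s) (size m).
    by exists m; [rewrite inE mc orbT|move=> u; rewrite inE => /orP[/eqP->//|/mmax]].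
  exists s; first exact: mem_head.
  by move=> u; rewrite inE => /orP[/eqP->//|/mmax um]; apply: leq_trans um (ltnW ms).
have [i c' c'E] := rot_to mc.
move: cc Uc c3 mmax; rewrite -(rot_cycle i) -(rot_uniq i) -(size_rot i) c'E.
have memc s : s \in m :: c' -> s \in c by rewrite -c'E mem_rot.
case: c' c'E memc => // s [|t c'] //= _ memc /and3P[ms st + ] Uc _ mmax.
rewrite rcons_path => /andP[_ lm].
have lin : last t c' \in m :: s :: t :: c'.
  by rewrite in_cons; apply/orP; right; rewrite in_cons mem_last orbT.
have sin : s \in m :: s :: t :: c' by rewrite !inE eqxx !orbT.
have [_ sE] := seq_adj_behead ms (mmax _ (memc _ sin)).
have [_ lE] : m != [::] /\ last t c' = behead m.
  by apply: seq_adj_behead (mmax _ (memc _ lin)); rewrite seq_adj_sym.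
move: Uc; rewrite sE -lE => /and3P[_ + _].
by rewrite mem_last.
Qed.

Lemma suffix_antisym s t : suffix s t -> suffix t s -> s = t.
Proof.
move=> /suffixP[r ->] /suffixP[q /(congr1 size)/eqP].
rewrite !size_cat addnA -[X in X == _]add0n eqn_add2r eq_sym addn_eq0 !size_eq0.
by case/andP=> _ /eqP->.
Qed.

Lemma suffix_cons_neq x s t : suffix s (x :: t) -> s != x :: t -> suffix s t.
Proof.
case/suffixP=> -[|y r] /= e; first by rewrite e eqxx.
by case: e => _ ->; rewrite suffix_suffix.
Qed.

Lemma seq_tree_cut t (u v : seq_tree) : adj u v -> suffix t u -> ~~ suffix t v ->
  u = t /\ v = behead t.
Proof.
move=> /= /orP[/andP[u0 /eqP->]|/andP[v0 /eqP->]] tu tv; last first.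
  case: v v0 tu tv => //= x v _ tv /negP[]; exact: suffix_trans tv (suffix_cons _ _).
case: u u0 tu tv => // x u _ tu /= ntu.
have [->//|ne] := eqVneq t (x :: u).
by case/negP: ntu; exact: suffix_cons_neq ne.
Qed.

(** The path stays in the subtree below [a]. If [t2] were not in [A], the path would also stay off
    the subtree below [t2], because a member of [A] there would force [t2] into [A]. *)
Lemma seq_tree_convex (A : set seq_tree) (a : seq_tree) :
  (forall t, A t -> t = a \/ t <> [::] /\ A (behead t)) ->
  forall (t1 t2 t3 : seq_tree) p, is_path t1 t3 p -> t2 \in p -> A t1 -> A t3 -> A t2.
Proof.
move=> Aup t1 t2 t3 p pP t2p A1 A3.
have Aa t : A t -> suffix a t.
  elim: t => [|x t IHt] At.
    by have [<-|[]//] := Aup _ At; rewrite suffix_refl.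
  have [<-|[_ /IHt at_]] := Aup _ At; first by rewrite suffix_refl.
  exact: suffix_trans at_ (suffix_cons _ _).
have at2 : suffix a t2.
  apply: (@path_cut seq_tree [set t | suffix a t] a (behead a) _ _ _ _ pP) t2p; [|exact: Aa..].
  by move=> u v uv au /negP; exact: seq_tree_cut.
have Adown t : A t -> suffix t2 t -> A t2.
  elim: t => [|x t IHt] At.
    by rewrite suffixs0 => /eqP->.
  have [-> //|ne t2t] := eqVneq t2 (x :: t).
  have [xta|[_ At']] := Aup _ At; last by apply: IHt => //; exact: suffix_cons_neq ne.
  by move: ne; rewrite (suffix_antisym t2t)// ?eqxx// xta.
have [//|nA] := pselect (A t2).
have : [set t | ~~ suffix t2 t] t2; last by rewrite /= suffix_refl.
apply: (@path_cut seq_tree _ (behead t2) t2 _ _ _ _ pP _ _ _ t2p) => /=; last 2 first.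
- by apply/negP => /(Adown _ A1).
- by apply/negP => /(Adown _ A3).
move=> u v uv nu /negP; rewrite negbK => tv.
by have [|-> ->] := @seq_tree_cut t2 v u _ tv nu; first by rewrite adj_sym.
Qed.

End SeqTree.

(** * From bags to a tree-decomposition *)

Section Decomposition.
Variables (G : sgraph) (K : Type) (k : nat).
Hypothesis infK : infinite_set [set: K].
Hypothesis k0 : k > 0.
Hypothesis bags : forall S : seq G,
  exists Z, [/\ [set` S] `<=` Z, small K Z & separating_bag k Z].
Implicit Types (R : set G) (s t : seq G).

Definition nb R := [set p | ~ R p /\ exists2 u, R u & adj u p].

(** One vertex of [R] is added to its neighbourhood so that the bag meets [R]; this progress is what
    makes the bags cover [G]. Stating the bound as an implication lets [choice] range over all
    [R]. *)
Lemma nb_bag R : exists Z, atmost k.-1 (nb R) ->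
  [/\ nb R `<=` Z, small K Z, separating_bag k Z & R !=set0 -> (Z `&` R) !=set0].
Proof.
have [[s _ sR]|nR] := pselect (atmost k.-1 (nb R)); last by exists set0.
have [[v Rv]|R0] := pselect (R !=set0).
  have [Z [SZ sZ sepZ]] := bags (v :: s); exists Z => _; split=> //.
    by move=> p /sR /= ps; apply: SZ; rewrite /= inE ps orbT.
  by move=> _; exists v; split=> //; apply: SZ; exact: mem_head.
have [Z [SZ sZ sepZ]] := bags s; exists Z => _; split=> //.
by move=> p /sR; exact: SZ.
Qed.

Definition bag0 := projT1 (choice nb_bag).
Definition bag R := bag0 R `&` (R `|` nb R).

Lemma bagP R : atmost k.-1 (nb R) ->
  [/\ nb R `<=` bag R, small K (bag R),
    forall x, R x -> ~ bag R x -> [/\ reach (bag R) x `<=` R,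
      nb (reach (bag R) x) `<=` bag R & atmost k.-1 (nb (reach (bag R) x))] &
    R !=set0 -> (bag R `&` R) !=set0].
Proof.
move=> Rk; have [nbZ sZ sepZ ZR] := projT2 (choice nb_bag) R Rk.
have nbB : nb R `<=` bag R by move=> p pR; split; [exact: nbZ|right].
split=> //.
- by apply: small_sub sZ => v [].
- move=> x Rx nBx.
  have CR : reach (bag R) x `<=` R.
    apply: reach_ind => // y z _ Ry yz nBz; apply: contrapT => nRz.
    by apply/nBz/nbB; split=> //; exists y.
  have CB : nb (reach (bag R) x) `<=` bag R.
    move=> p [nCp [u Cu up]]; apply: contrapT => nBp; apply: nCp.
    exact: reach_step up nBp.
  (* Within [R] the bag agrees with [bag0 R], so the component also avoids [bag0 R] and inherits the
     bound on its attachments. *)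
  split=> //; apply: atmost_sub (sepZ x _); last by move=> Zx; apply: nBx; split; [|left].
  move=> p pC; split; first by have [] := CB _ pC.
  have [_ [u Cu up]] := pC; exists u => //; move: u Cu {up}.
  have nZ y : R y -> ~ bag R y -> ~ bag0 R y.
    by move=> Ry nBy Zy; apply: nBy; split=> //; left.
  apply: reach_ind => [|y z xy xy0 yz nBz]; first by apply: reach_refl; exact: nZ.
  by apply: (reach_step xy0 yz); apply: nZ => //; apply: CR; exact: (reach_step xy yz nBz).
- move=> /ZR[v [Zv Rv]]; exists v; split=> //; split=> //; by left.
Qed.

(* The child of [s] for a component of [reg s] minus its bag is indexed by a canonical
   representative of that component; other indices give empty regions. *)
Fixpoint reg s : set G := if s is x :: t then
    [set v | [/\ reg t x, x = xget x (reach (bag (reg t)) x) & reach (bag (reg t)) x v]]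
  else setT.

Definition part s := bag (reg s).

Lemma reg_consE x s v : reg (x :: s) v -> reg (x :: s) = reach (part s) x /\ reg s x /\ ~ part s x.
Proof.
move=> [sx xE xv]; split; last by split=> //; have [] := reach_out xv.
by apply/seteqP; split=> u // [].
Qed.

Lemma nb_reg s : atmost k.-1 (nb (reg s)).
Proof.
elim: s => [|x s IHs]; first by exists [::] => // p [] /(_ I).
have [[v sv]|nv] := pselect (exists v, reg (x :: s) v).
  have [-> [sx nBx]] := reg_consE sv; have [_ _ h _] := bagP IHs.
  by have [] := h _ sx nBx.
by exists [::] => // p [_ [u su]]; case: nv; exists u.
Qed.

Lemma nb_part s : nb (reg s) `<=` part s.
Proof. by have [] := bagP (nb_reg s). Qed.

Lemma reg_cons_sub x s : reg (x :: s) `<=` reg s.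
Proof.
move=> v sv; have [E [sx nBx]] := reg_consE sv; have [_ _ h _] := bagP (nb_reg s).
by have [CR _ _] := h _ sx nBx; apply: CR; rewrite -/(part s) -E.
Qed.

Lemma reg_cons_npart x s v : reg (x :: s) v -> ~ part s v.
Proof. by move=> [_ _ xv]; have [] := reach_out xv. Qed.

Lemma nb_cons_part x s : nb (reg (x :: s)) `<=` part s.
Proof.
move=> p [np [u su up]]; have [E [sx nBx]] := reg_consE su.
have [_ _ h _] := bagP (nb_reg s); have [_ CB _] := h _ sx nBx; apply: CB.
by rewrite -/(part s) -E; split=> //; exists u.
Qed.

Lemma reach_same (D : set G) x y : reach D x y -> reach D x = reach D y.
Proof.
move=> xy; apply/seteqP; split=> z; last exact: reach_trans.
by apply: reach_trans; exact: reach_sym.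
Qed.

(** [reg] uses the index itself as the default of [xget], which must not influence the
    representative of a component. *)
Lemma xget_default (x y z : G) (P : set G) : P z -> xget x P = xget y P.
Proof. by move=> Pz; rewrite /xget; case: pselect => // -[]; exists z; exact/asboolP. Qed.

Lemma reg_child s v : reg s v -> ~ part s v -> exists x, reg (x :: s) v.
Proof.
move=> sv nBv; pose x := xget v (reach (part s) v).
have vx : reach (part s) v x by apply: (xgetI v); exact: reach_refl.
have [_ _ h _] := bagP (nb_reg s); have [CR _ _] := h _ sv nBv.
exists x; split; [exact: CR| |exact: reach_sym].
by rewrite -/(part s) -(reach_same vx) -(xget_default v x vx).
Qed.

Lemma reg_child_uniq x y s v : reg (x :: s) v -> reg (y :: s) v -> x = y.
Proof.
move=> [_ xE xv] [_ yE yv].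
have xy : reach (part s) x y := reach_trans xv (reach_sym yv).
apply: (etrans xE); apply: (etrans _ (esym yE)).
by rewrite -/(part s) -(reach_same xy); exact: xget_default xy.
Qed.

Lemma reg_child_adj x s u v : reg (x :: s) u -> adj u v -> ~ part s v -> reg (x :: s) v.
Proof. by move=> [sx xE xu] uv nBv; split=> //; exact: reach_step uv nBv. Qed.

Lemma reg_connected x s u v : reg (x :: s) u -> reg (x :: s) v ->
  reach (~` reg (x :: s)) u v.
Proof.
move=> su sv; have [E _] := reg_consE su.
have uv : reach (part s) u v.
  by move: su sv; rewrite E => xu xv; apply: reach_trans xv; exact: reach_sym.
have : reach (~` reg (x :: s)) u v /\ reg (x :: s) v; last by case.
move: v {sv} uv; apply: reach_ind; first by split=> //; apply: reach_refl; exact.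
move=> y z _ [uy sy] yz nBz; have sz := reg_child_adj sy yz nBz.
by split=> //; apply: reach_step uy yz _; exact.
Qed.

Lemma reg_suffix s t : suffix s t -> reg t `<=` reg s.
Proof.
move=> /suffixP[r ->]; elim: r => //= x r IHr.
by move=> v /(@reg_cons_sub x)/IHr.
Qed.

Lemma reg_size_eq s t v : size s = size t -> reg s v -> reg t v -> s = t.
Proof.
elim: s t => [|x s IHs] [|y t] // [st] sv tv.
have e := IHs _ st (reg_cons_sub sv) (reg_cons_sub tv).
by rewrite -e in tv *; rewrite (reg_child_uniq sv tv).
Qed.

Lemma reg_chain s t v : size s <= size t -> reg s v -> reg t v -> suffix s t.
Proof.
move=> st sv tv; have t's := suffix_drop t (size t - size s).
rewrite (@reg_size_eq s (drop (size t - size s) t) v)//.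
  by rewrite size_drop subKn.
exact: reg_suffix t's _ tv.
Qed.

(* If the regions containing [v] went down forever, the component of [v] in their intersection
   would have a finite neighbourhood, hence would coincide with all but finitely many of these
   regions; but each region meets its bag. *)
Lemma part_cover v : exists t, part t v.
Proof.
apply: contrapT => /forallNP nv.
have /choice[nxt nxtP] s : exists x, reg s v -> reg (x :: s) v.
  have [sv|ns] := pselect (reg s v); last by exists v.
  by have [x xv] := reg_child sv (nv s); exists x.
pose t n := iter n (fun s => nxt s :: s) [::].
pose C n := reg (t n).
have Cv n : C n v by elim: n => //= n IHn; exact: nxtP.
have CS n : C n.+1 `<=` C n by exact: reg_cons_sub.
have Cle m n : m <= n -> C n `<=` C m.
  by move=> /subnKC <-; elim: (n - m) => [|d IHd] u; rewrite ?addn0// addnS => /CS/IHd.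
pose I := \bigcap_n C n.
pose D := reach (~` I) v.
have Iv : I v by move=> n _.
have DI : D `<=` I by move=> u vu; have [_ /contrapT] := reach_out vu.
have nbD w : nb D w -> exists n, forall m, n <= m -> nb (C m) w.
  move=> [nDw [u Du uw]]; have [n nw] : exists n, ~ C n w.
    apply: contrapT => /forallNP nw; apply: nDw; apply: reach_step uw _ => //.
    by apply=> n _; have /contrapT := nw n.
  exists n => m nm; split; first by move=> /(Cle _ _ nm).
  by exists u => //; exact: (DI _ Du).
have nbDs (s : seq G) : [set` s] `<=` nb D -> exists n, forall m, n <= m -> [set` s] `<=` nb (C m).
  elim: s => [_|w s IHs sD]; first by exists 0.
  have [|n1 h1] := IHs; first by move=> x xs; apply: sD; rewrite /= inE xs orbT.
  have [n2 h2] := nbD w (sD _ (mem_head _ _)).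
  exists (maxn n1 n2) => m; rewrite geq_max => /andP[m1 m2] x /=.
  by rewrite inE => /orP[/eqP->|]; [exact: h2|exact: h1].
have Dk : atmost k.-1 (nb D).
  apply: contrapT => /atmostPn[s [Us sk sD]]; have [n /(_ n (leqnn n)) sn] := nbDs s sD.
  by have := atmost_uniq (nb_reg (t n)) Us sn; rewrite sk ltnn.
have [s [_ _ sE]] := atmost_exact Dk.
have [n nP] : exists n, forall m, n <= m -> nb D `<=` nb (C m).
  by rewrite sE; apply: nbDs; rewrite sE.
(* From [n] on, the neighbours of [D] lie outside the regions, so a connected region containing [v]
   cannot leave [D]. *)
have CD m : n <= m -> C m.+1 `<=` D.
  move=> nm u Cu; have := reg_connected (Cv m.+1) Cu.
  move: u {Cu}; apply: reach_ind; first by apply: reach_refl; exact.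
  move=> y z _ Dy yz /contrapT Cz; apply: contrapT => nDz.
  have [] : nb (C m.+1) z; last by [].
  by apply: (nP _ (leqW nm)); split=> //; exists y.
(* A vertex of the bag of [C n.+1] inside that region lies in [D], hence in the next region, which
   avoids this bag. *)
have [_ _ _ /(_ (ex_intro _ v (Cv n.+1)))[w [Bw Cw]]] := bagP (nb_reg (t n.+1)).
have Cw' : C n.+2 w by have := DI _ (CD _ (leqnn n) _ Cw); exact.
exact: (@reg_cons_npart (nxt (t n.+1)) (t n.+1) w Cw' Bw).
Qed.

(** The top of the subtree formed by the nodes whose parts contain [v]. *)
Definition home v t := reg t v /\ part t v.

Lemma home_exists v : exists t, home v t.
Proof.
have [t tv] := part_cover v; elim: t tv => [|x t IHt] tv; first by exists [::].
have [sv|nsv] := pselect (reg (x :: t) v); first by exists (x :: t).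
by apply: IHt; apply: (@nb_cons_part x); case: tv => _ [].
Qed.

Lemma home_suffix v s t : home v t -> reg s v -> suffix s t.
Proof.
move=> [tv pv] sv; have [st|ts] := leqP (size s) (size t).
  exact: reg_chain st sv tv.
have /suffixP[r e] := reg_chain (ltnW ts) tv sv.
case/lastP: r e => [e|r x]; first by rewrite e ltnn in ts.
rewrite cat_rcons => e; exfalso; apply: (@reg_cons_npart x t v) => //.
by apply: reg_suffix sv; rewrite e suffix_suffix.
Qed.

Lemma part_decomposition : @tree_decomposition G (seq_tree G) part.
Proof.
split.
- exact: seq_tree_is_tree.
- by move=> v; have [t [_ tv]] := home_exists v; exists t.
- move=> u v uv; have [s hu] := home_exists u; have [t hv] := home_exists v.
  wlog st : u v s t uv hu hv / size s <= size t.
    move=> wl; have [st|/ltnW ts] := leqP (size s) (size t); first exact: wl hu hv st.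
    by rewrite adj_sym in uv; have [r [ru rv]] := wl _ _ _ _ uv hv hu ts; exists r.
  (* At the longer home [t], either [u] lies in the region, and then its home is [t], or [u] is a
     neighbour of the region and so lies in its bag. *)
  exists t; split; last by case: hv.
  have [tu|ntu] := pselect (reg t u).
    have /suffixP[r e] := home_suffix hu tu.
    suff <- : s = t by case: hu.
    move: st; rewrite e size_cat -[X in _ <= X]add0n leq_add2r leqn0 size_eq0.
    by move/eqP->.
  by apply: nb_part; split=> //; exists v; [case: hv|rewrite adj_sym].
- move=> t1 t2 t3 p pP t2p v [v1 v3]; have [a [av pv]] := home_exists v.
  apply: (@seq_tree_convex G [set t | part t v] a _ _ _ _ _ pP t2p v1 v3) => t tv.
  have [rv|nrv] := pselect (reg t v).
    left; apply: suffix_antisym; first exact: home_suffix rv.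
    exact: home_suffix av.
  right; case: t tv nrv => [_ []//|x t tv nrv]; split=> //.
  by apply: (@nb_cons_part x); case: tv => _ [].
Qed.

(** A child region avoids the bag of its parent, so the two bags share only neighbours of the child
    region. *)
Lemma part_adhesion : @adhesion_lt G (seq_tree G) part k.
Proof.
move=> s t /orP[]; [case: s => // x s|case: t => // x t] => /andP[_ /eqP->] /=.
  apply/card_lt_atmost; split=> //; apply: atmost_sub (nb_reg (x :: s)).
  by move=> v [[_ [/reg_cons_npart sv|]]].
apply/card_lt_atmost; split=> //; apply: atmost_sub (nb_reg (x :: t)).
by move=> v [pv [_ [/reg_cons_npart sv|]]].
Qed.

Theorem decomposition_exists : has_decomposition G k K.
Proof.
exists (seq_tree G), part; split.
- exact: part_decomposition.
- exact: part_adhesion.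
- by move=> t; apply/card_lt_small; have [_ + _ _] := bagP (nb_reg t).
Qed.

End Decomposition.

(** * k-connected sets and tree-decompositions *)

Lemma linked_card_le (G : sgraph) (Z1 Z2 P : set G) : linked Z1 Z2 ->
  (forall x y s, Z1 x -> Z2 y -> is_path x y s -> exists2 v, v \in s & P v) ->
  Z1 #<= P.
Proof.
move=> [F [FZ Fpath Fdis]] hit.
have /card_eqPle[_ ZF] := FZ; apply: (card_le_trans ZF).
apply/card_le_relP; exists (fun s v => v \in s /\ P v); split.
  by move=> s /Fpath[x [y [Zx Zy /(hit _ _ _ Zx Zy)[v vs Pv]]]]; exists v.
move=> s t v Fs Ft [vs _] [vt _]; apply: contrapT => st.
exact: (Fdis _ _ Fs Ft st v).
Qed.

Section TreeDecomposition.
Variables (G T : sgraph) (part : T -> set G) (k : nat) (X : set G).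
Hypothesis tdec : tree_decomposition part.
Hypothesis adh : adhesion_lt part k.
Hypothesis infX : infinite_set X.
Hypothesis kX : k_connected k X.
Implicit Types (t u : T) (U : set T).

Let treeT : is_tree T. Proof. by case: tdec. Qed.

Lemma tree_path (s t : T) : exists p, is_path s t p.
Proof. by have [[_]] := treeT. Qed.

(** For adjacent [t] and [t'] these are the nodes beyond the edge: the component of [t'] in the tree
    without [t]. *)
Definition side t t' := reach [set t] t'.

(** Any other edge leaving the side would end in [t] and close a cycle with the edge from [t] to
    [t']. *)
Lemma side_cut t t' u v : adj t t' -> adj u v -> side t t' u -> ~ side t t' v ->
  u = t' /\ v = t.
Proof.
move=> tt' uv su nsv.
have vt : v = t.
  by apply: contrapT => nvt; apply: nsv; exact: reach_step uv nvt.
split=> //; have [p [q [pE qp Up lq]] pt] := reach_is_path su; rewrite pE in Up.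
have [_ acyc] := treeT.
have : size (t :: p) <= 2.
  apply: acyc; rewrite /ucycle pE /= rcons_path lq tt' qp -{1}vt uv /=.
  move: (Up) => /= ->.
  by rewrite andbT; apply/negP => tq; apply: (pt t) => //; rewrite pE.
by case: q pE qp lq {Up} => [|w q] -> // _ <-.
Qed.

Lemma path_in t t' s s' p : adj t t' -> path (@adj T) s p -> last s p = s' ->
  side t t' s -> ~ side t t' s' -> t \in s :: p /\ t' \in s :: p.
Proof.
move=> tt' sp ps' ss ns'; rewrite -ps' in ns'.
have [u [v [us vs uv su nsv]]] := path_exit sp ss ns'.
by have [<- <-] := side_cut tt' uv su nsv.
Qed.

Lemma path_in_out t t' s s' p : adj t t' -> path (@adj T) s p -> last s p = s' ->
  ~ side t t' s -> side t t' s' -> t \in s :: p /\ t' \in s :: p.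
Proof.
move=> tt' sp ps' nss ss'; rewrite -ps' in ss'.
have [|u [v [us vs uv su /contrapT nsv]]] := @path_exit _ (~` side t t') s p sp nss.
  by rewrite /setC /=; apply.
by rewrite adj_sym in uv; have [<- <-] := side_cut tt' uv nsv su.
Qed.

Lemma not_both_sides t t' s : adj t t' -> side t t' s -> ~ side t' t s.
Proof.
move=> tt' ss [p [tp ps pt']].
have nst : ~ side t t' t by move=> tt; have [_ /(_ erefl)] := reach_out tt.
by have [_ /pt'/(_ erefl)] := path_in_out tt' tp ps nst ss.
Qed.

Definition parts U := [set v | exists2 s, U s & part s v].

Lemma parts_side t t' v : adj t t' -> parts (side t t') v -> parts (~` side t t') v ->
  (part t `&` part t') v.
Proof.
move=> tt' [s ss sv] [s' ss' s'v]; have [p pP] := tree_path s s'.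
have [q [pE sq _ lq]] := pP; have [tp t'p] := path_in tt' sq lq ss ss'.
have [_ _ _ conv] := tdec.
rewrite -pE in tp t'p.
by split; apply: (conv _ _ _ _ pP _ v (conj sv s'v)).
Qed.

Lemma path_meets t t' x y s : adj t t' -> parts (side t t') x ->
  parts (~` side t t') y -> is_path x y s ->
  exists2 v, v \in s & (part t `&` part t') v.
Proof.
move=> tt' sx sy [p [-> xp _ py]].
(* The path leaves [W] along an edge; a part containing this edge lies on the side of [t'], so the
   far end of the edge occurs in parts on both sides. *)
pose W := [set z | parts (side t t') z /\ ~ parts (~` side t t') z].
have [nx|nnx] := pselect (parts (~` side t t') x).
  by exists x; [exact: mem_head|exact: parts_side].
have Wl : ~ W (last x p) by rewrite py => -[].
have [u [v [us vs uv [su nsu] Wv]]] := path_exit xp (conj sx nnx : W x) Wl.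
have [_ _ edge _] := tdec; have [r [ru rv]] := edge _ _ uv.
exists v => //; have sv : parts (side t t') v.
  exists r => //; apply: contrapT => nr; apply: nsu; by exists r.
by apply: parts_side => //; apply: contrapT => nv; apply: Wv.
Qed.

Definition thin U := atmost k.-1 (X `&` parts U).

Lemma linked_meet (a b : seq G) (P : set G) : uniq a -> uniq b ->
  size a = k -> size b = k -> [set` a] `<=` X -> [set` b] `<=` X ->
  (forall x y s, x \in a -> y \in b -> is_path x y s -> exists2 v, v \in s & P v) ->
  ~ card_lt P `I_k.
Proof.
move=> Ua Ub ak bk aX bX hit Pk; have [_ kl] := kX.
have aE : [set` a] #= `I_k by rewrite -ak; exact: card_uniq_seq.
have bE : [set` b] #= `I_k by rewrite -bk; exact: card_uniq_seq.
have lab : linked [set` a] [set` b].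
  apply: kl => //; first by rewrite (card_eql aE) card_eq_sym.
  by have /card_eqPle[] := aE.
have aP := linked_card_le lab hit; move: Pk => /andP[Pk /negP]; apply.
by apply/card_eqPle; split=> //; have /card_eqPle[_ h] := aE; exact: card_le_trans aP.
Qed.

(** Otherwise [k] disjoint paths between vertices of [X] on the two sides would pass through fewer
    than [k] adhesion vertices. *)
Lemma thin_side t t' : adj t t' -> thin (side t t') \/ thin (~` side t t').
Proof.
move=> tt'; have Pk := adh tt'; have [k0 _] := (card_lt_atmost _ _).1 Pk.
apply: contrapT => /not_orP[/atmostPn[a [Ua ak aX]] /atmostPn[b [Ub bk bX]]].
rewrite prednK// in ak bk.
apply: (linked_meet Ua Ub ak bk _ _ _ Pk) => [v /aX[]//|v /bX[]//|x y s xa yb].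
by have [_ sx] := aX _ xa; have [_ sy] := bX _ yb; exact: path_meets.
Qed.

Lemma infinite_atmost (A : set G) n : infinite_set A -> ~ atmost n A.
Proof. by move=> infA /atmost_finite. Qed.

(* The vertices of [X] outside of [part t] are distributed over fibres indexed by the adhesion sets
   at [t]; each fibre is finite since an adhesion set separates a branch from the others. *)
Lemma sink_card (K : Type) t : infinite_set [set: K] ->
  (forall t', adj t t' -> thin (side t t')) -> small K (part t) -> small K X.
Proof.
move=> infK sink st.
have /choice[tau tauP] x : exists t', ~ part t x -> adj t t' /\ parts (side t t') x.
  have [tx|ntx] := pselect (part t x); first by exists t.
  have [_ cover _ _] := tdec; have [s sx] := cover x.
  have [p [[|t' q] [-> tq Uq lq]]] := tree_path t s.
    by case: ntx; rewrite [t]lq.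
  exists t' => _; move: tq Uq lq => /= /andP[tt' t'q] /andP[tNq _] lq.
  split=> //; exists s => //; exists q; split=> // z zq /= zt.
  by rewrite -zt zq in tNq.
have /choice[e eP] t' : exists s : seq G, adj t t' ->
    size s < k /\ part t `&` part t' = [set` s].
  have [tt'|ntt'] := pselect (adj t t'); last by exists [::].
  have [k0 /atmost_exact[s [_ sk sE]]] := (card_lt_atmost _ _).1 (adh tt').
  by exists s => _; split=> //; rewrite -(ltn_predK k0) ltnS.
pose F s := [set x | [/\ X x, ~ part t x & e (tau x) = s]].
have finF s : finite_set (F s).
  apply: contrapT => infF.
  have [x0 [Xx0 nx0 sE]] := infinite_setN0 infF.
  have [tt0 _] := tauP _ nx0; have [sk seE] := eP _ tt0; rewrite sE in sk seE.
  have k0 : 0 < k by exact: leq_ltn_trans sk.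
  (* The list [a] has [k] vertices of the fibre, and [b] will have [k] more outside the branches of
     [a], which contain only finitely many vertices of [X]. All paths from [a] to [b] meet the
     common adhesion set [s]. *)
  have [a [Ua ak aF]] := atmostPn (infinite_atmost (n := k.-1) infF).
  rewrite prednK// in ak.
  pose N := [set y | exists2 x, x \in a & (X `&` parts (side t (tau x))) y].
  have finN : finite_set N.
    rewrite (_ : N = \bigcup_(x in [set` a]) (X `&` parts (side t (tau x))))//.
    apply: bigcup_finite => [|x /aF[_ nx _]]; first exact: finite_seq.
    by have [tx _] := tauP _ nx; exact: atmost_finite (sink _ tx).
  have infFN : infinite_set (F s `\` N).
    move=> finFN; apply: infF; apply: (@sub_finite_set _ _ ((F s `\` N) `|` N)).
      by move=> x Fx; have [Nx|Nx] := pselect (N x); [right|left].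
    by rewrite finite_setU.
  have [b [Ub bk bF]] := atmostPn (infinite_atmost (n := k.-1) infFN).
  rewrite prednK// in bk.
  apply: (@linked_meet a b [set` s] Ua Ub ak bk) => [v /aF[]//|v /bF[[]]//|x y p xa yb xy|].
    have [Xx nx ex] := aF _ xa; have [[Xy ny ey] nN] := bF _ yb.
    have [tx sx] := tauP _ nx.
    have sy : parts (~` side t (tau x)) y.
      have [_ cover _ _] := tdec; have [r ry] := cover y.
      exists r => // sr; apply: nN; exists x => //; split=> //; by exists r.
    have [v vp] := path_meets tx sx sy xy.
    by have [_ ->] := eP _ tx; rewrite ex; exists v.
  apply/card_lt_atmost; split=> //; exists s => //.
  by rewrite -ltnS prednK.
apply: (small_sub _ (small_setU infK st (small_bigcup_seq (n := k) infK st finF))) => x Xx.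
have [tx|ntx] := pselect (part t x); [by left|right].
have [tt' _] := tauP _ ntx; have [sk sE] := eP _ tt'.
exists (e (tau x)) => //; split=> // z ze.
by have [] : (part t `&` part (tau x)) z by rewrite sE.
Qed.

(* Otherwise some ray has thin sides behind its edges, which increase and exhaust [X]. *)
Lemma sink_exists : exists t, forall t', adj t t' -> thin (side t t').
Proof.
apply: contrapT => /forallNP nosink.
have /choice[g gP] t : exists t', adj t t' /\ thin (~` side t t').
  have /existsNP[t' /not_implyP[tt' nthin]] := nosink t.
  by exists t'; split=> //; have [] := thin_side tt'.
have [[[t0] _] _] := treeT.
pose t n := iter n g t0.
pose A n := ~` side (t n) (t n.+1).
have tadj n : adj (t n) (t n.+1) by have [] := gP (t n).
have thinA n : thin (A n) by have [] := gP (t n).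
(* If the ray turned back, both sides of one edge would be thin and [X] would be finite. *)
have backN n : t n.+2 <> t n.
  move=> e; apply: infX.
  apply: (@sub_finite_set _ _ ((X `&` parts (A n)) `|` (X `&` parts (A n.+1)))).
    move=> x Xx; have [_ cover _ _] := tdec; have [s sx] := cover x.
    have [sn|nsn] := pselect (side (t n) (t n.+1) s).
      right; split=> //; exists s => //; suff : ~ side (t n.+1) (t n.+2) s by [].
      by rewrite e; exact: not_both_sides (tadj n) sn.
    by left; split=> //; exists s.
  by rewrite finite_setU; split; exact: atmost_finite (thinA _).
have selfA n : A n (t n) by move=> tt; have [_ /(_ erefl)] := reach_out tt.
have nextA n : side (t n) (t n.+1) (t n.+1).
  by apply: reach_refl => e; have := tadj n; rewrite [t n.+1]e adj_irr.
have AS n : A n `<=` A n.+1.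
  move=> s nsn [p [tp ps pt]].
  have sn : side (t n) (t n.+1) (t n.+2).
    by apply: reach_step (nextA n) (tadj n.+1) _; exact: backN.
  by have [_ /pt/(_ erefl)] := path_in (tadj n) tp ps sn nsn.
have Ale m n : m <= n -> A m `<=` A n.
  by move=> /subnKC <-; elim: (n - m) => [|d IHd] u; rewrite ?addn0// addnS => /IHd/AS.
have tinj i j : i < j -> t i <> t j.
  case: j => // j ij e; have nti : ~ side (t j) (t j.+1) (t i) := Ale i j ij _ (selfA i).
  by apply: nti; rewrite e; exact: nextA.
(* The path from [t0] to a node that stays ahead of the ray forever would contain all the distinct
   nodes [t n.+1]. *)
have Acover s : exists n, A n s.
  apply: contrapT => /forallNP nA; have [p [q [pE tq _ lq]]] := tree_path t0 s.
  have inq n : t n.+1 \in t0 :: q.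
    have t0n : ~ side (t n) (t n.+1) t0 := Ale 0 n (leq0n n) _ (selfA 0).
    by have [_] := path_in_out (tadj n) tq lq t0n (contrapT (nA n)).
  have : size [seq t i | i <- iota 1 (size q).+2] <= size (t0 :: q).
    apply: uniq_leq_size.
      rewrite map_inj_uniq ?iota_uniq// => i j e.
      by case: (ltngtP i j) => // /tinj; rewrite e.
    by move=> _ /mapP[[|i] + ->]; rewrite mem_iota.
  by rewrite size_map size_iota ltnn.
have [s [Us sk sX]] := atmostPn (infinite_atmost (n := k.-1) infX).
have [n sn] : exists n, [set` s] `<=` parts (A n).
  elim: s sX {Us sk} => [_|x s IHs sX]; first by exists 0.
  have [|n1 h1] := IHs; first by move=> v vs; apply: sX; rewrite /= inE vs orbT.
  have [_ cover _ _] := tdec; have [r rx] := cover x; have [n2 h2] := Acover r.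
  exists (maxn n1 n2) => v /=; rewrite inE => /orP[/eqP->|/h1[r' r'A r'v]].
    by exists r => //; apply: Ale h2; exact: leq_maxr.
  by exists r' => //; apply: Ale r'A; exact: leq_maxl.
have := atmost_uniq (thinA n) Us _; rewrite sk ltnn => /(_ _)/notF; apply => v vs.
by split; [exact: sX|exact: sn].
Qed.

End TreeDecomposition.

Theorem k_connected_no_decomposition (G : sgraph) (k : nat) (K : Type) (X : set G) :
  infinite_set [set: K] -> X #= [set: K] -> k_connected k X -> ~ has_decomposition G k K.
Proof.
move=> infK XK kX [T [part [tdec adh sparts]]].
have /card_eqPle[_ KX] := XK.
have infX : infinite_set X by move=> /(card_le_finite KX).
have [t sink] := sink_exists tdec adh infX kX.
by apply: (sink_card tdec adh kX infK sink) KX; exact/card_lt_small.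
Qed.

(** * The duality *)

(** If [R] met all walks, let [B] be [R] with everything that [a] reaches outside [R]; its boundary
    lies in [R]. As [a] is too large for [B], the vertices of [b] outside the interior are no more
    than the boundary; the others lie in [R] off the boundary, so [b] would be no larger than
    [R]. *)
Lemma inseparable_walk (G : sgraph) k (X : set G) (a b R : seq G) :
  inseparable k set0 X -> uniq a -> uniq b -> size a = size b -> size a <= k ->
  [set` a] `<=` X -> [set` b] `<=` X -> size R < size a ->
  exists2 s, walk (@adj G) a b s & ~~ has (mem R) s.
Proof.
move=> iX Ua Ub ab ak aX bX Ra; apply: contrapT => nowalk.
pose B := [set v | v \in R \/ exists2 x, x \in a & reach [set` R] x v].
have BR : bd set0 B `<=` [set` R].
  move=> v [[//|[x xa xv]] [//|[u vu nBu]]]; exfalso; apply: nBu.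
  have [uR|uR] := boolP (u \in R); [by left|right; exists x => //].
  by apply: (reach_step xv vu); exact/negP.
have [t [Ut tR tE]] := atmost_exact (atmost_sub BR (atmost_seq R)).
have tsub : {subset t <= R} by move=> v vt; apply: BR; rewrite tE.
have tk : size t < k by exact: leq_ltn_trans tR (leq_trans Ra ak).
have tB : atmost (size t) (bd set0 B) by rewrite tE; exact: atmost_seq.
have [Bt|Bt] := iX B _ (@sub0set _ B) tk tB.
  have := leq_trans (atmost_uniq Bt Ua _) tR; rewrite leqNgt Ra => /(_ _)/notF; apply=> v va.
  split; first by left; exact: aX.
  have [vR|vR] := boolP (v \in R); [by left|right; exists v => //].
  by apply: reach_refl; exact/negP.
pose c := [seq v <- b | `[<inter set0 B v>]].
have cR : {subset c <= R}.
  move=> v; rewrite mem_filter => /andP[/asboolP[[//|[x xa [p [xp px pR]]]] _ _] vb].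
  exfalso; apply: nowalk; exists (x :: p); first by rewrite /= xa xp px.
  by apply/hasPn => z /pR/negP.
have tc : size (t ++ c) <= size R.
  apply: uniq_leq_size => [|v]; last by rewrite mem_cat => /orP[/tsub|/cR].
  rewrite cat_uniq Ut filter_uniq// andbT; apply/hasPn => v.
  rewrite mem_filter => /andP[/asboolP iv _]; apply/negP => vt.
  by apply: (inter_nbd iv); rewrite tE.
have bc : size [seq v <- b | ~~ `[<inter set0 B v>]] <= size t.
  apply: (atmost_uniq Bt); first exact: filter_uniq.
  by move=> v /=; rewrite mem_filter => /andP[/asboolPn nv vb]; split=> //; left; exact: bX.
move: Ra; rewrite ltnNge ab => /negP; apply; apply: leq_trans tc.
rewrite -(count_predC (fun v => `[<inter set0 B v>]) b) size_cat addnC -!size_filter.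
by rewrite leq_add2r.
Qed.

Lemma inseparable_k_connected (G : sgraph) k (X : set G) :
  infinite_set X -> inseparable k set0 X -> k_connected k X.
Proof.
move=> /infiniteP NX iX; split.
  by apply: card_le_trans NX; exact: card_leT.
move=> Z1 Z2 Z1X Z2X Z12 Z1k.
have /atmost_exact[a [Ua ak aE]] := (card_le_atmost _ _).1 Z1k.
have Z2k : Z2 #<= `I_k by move: Z12; rewrite card_eq_le => /andP[_ h]; exact: card_le_trans Z1k.
have /atmost_exact[b [Ub bk bE]] := (card_le_atmost _ _).1 Z2k.
rewrite {}aE {}bE in Z12 Z1X Z2X *.
have Ia := card_uniq_seq Ua; have Ib := card_uniq_seq Ub.
have ab : size a = size b.
  by apply/card_eq_II; rewrite -(card_eql Ia) -(card_eqr Ib).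
have [f [fw fd] Uf] := menger (fun R => inseparable_walk iX Ua Ub ab ak Z1X Z2X).
exists [set f i | i in `I_(size a)]; split.
- rewrite (card_eqr Ia); apply: inj_card_eq => i j; rewrite !inE /= => ia ja fij.
  have := fw _ ia; case E : (f i) => [|x p] // _.
  by apply: (fd i j x) => //; rewrite -?fij E mem_head.
- move=> _ [i ia <-]; have := fw _ ia; have := Uf _ ia.
  case: (f i) => [|x p] // Up /= /and3P[xa xp lb].
  by exists x, (last x p); split=> //; exists p.
- move=> _ _ [i ia <-] [j ja <-] ij v [vi vj].
  by apply: ij; congr f; exact: fd vi vj.
Qed.

(** * The k-tree-width as an attained minimum *)

Lemma has_decomposition_le (G : sgraph) k (L L' : Type) : [set: L] #<= [set: L'] ->
  has_decomposition G k L -> has_decomposition G k L'.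
Proof.
move=> LL' [T [part [td adh sp]]]; exists T, part; split=> // t.
apply/card_lt_small => L't; have /card_lt_small := sp t.
by apply; exact: card_le_trans LL' L't.
Qed.

Lemma unit_adj_irr : irreflexive (fun _ _ : unit => false). Proof. by []. Qed.

Definition unit_tree := @SGraph unit (fun _ _ => false) (fun _ _ => erefl) unit_adj_irr.

Lemma unit_tree_is_tree : is_tree unit_tree.
Proof.
split; last by move=> [|x [|y c]].
by split=> [|[] []]; [exact: inhabits tt|exists [:: tt], [::]].
Qed.

Lemma Cantor_card T : ~ ([set: set T] #<= [set: T]).
Proof.
move=> /card_le_relP[R [Rtot Rinj]].
pose D := [set x | exists2 A, R A x & ~ A x].
have [x _ Dx] := Rtot D I.
have nDx : ~ D x by move=> Dx'; have [A Ax] := Dx'; rewrite (Rinj A D x I I Ax Dx).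
by apply: (nDx); exists D.
Qed.

Lemma has_decomposition_powerset (G : sgraph) k : has_decomposition G k (set G).
Proof.
exists unit_tree, (fun _ => setT); split=> //.
  split=> [|v|u v _|] //; [exact: unit_tree_is_tree|by exists tt..].
by move=> t; apply/card_lt_small => h; exact: Cantor_card h.
Qed.

(** To apply [card_min], the candidates are restricted to subsets of [set G], which itself qualifies
    by the decomposition into one part. Any type [L'] is at least as large as [set G] or equipotent
    to such a subset. *)
Lemma k_tree_width_gt (G : sgraph) k (K : Type) : ~ has_decomposition G k K <->
  exists L : Type, is_k_tree_width G k L /\ card_lt [set: K] [set: L].
Proof.
split=> [nK|[L [[_ Lmin] /card_lt_small KL]] /Lmin//].
pose P (A : set (set G)) := has_decomposition G k A.
have TG : has_decomposition G k [set: set G].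
  apply: has_decomposition_le (has_decomposition_powerset G k).
  by have /card_eqPle[] := card_setT_sym [set: set G].
have [[A kA] Amin] := @card_min {A | P A} (set G) (fun A => proj1_sig A) (exist P _ TG).
exists A; split; last first.
  by apply/card_lt_small => AK; apply: nK; exact: has_decomposition_le AK kA.
split=> // L' kL'; rewrite (card_le_eql (card_setT A)).
have [GL|/(card_le_inj set0)[f [_ finj]]] := card_le_total [set: set G] [set: L'].
  by apply: card_le_trans GL; exact: card_leT.
have rE : range f #= [set: L'] by apply: inj_card_eq => x y _ _; exact: finj.
have kr : has_decomposition G k (range f).
  apply: has_decomposition_le kL'.
  by rewrite (card_le_eqr (card_setT (range f))); have /card_eqPle[] := rE.
by apply: card_le_trans (Amin (exist P _ kr)) _; have /card_eqPle[] := rE.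
Qed.

Lemma card_eq_subset T (K : Type) (X : set T) : X !=set0 -> [set: K] #<= X ->
  exists2 Y, Y `<=` X & Y #= [set: K].
Proof.
move=> [x0 _] /(card_le_inj x0)[f [fX finj]]; exists (range f).
  by move=> _ [l _ <-]; exact: fX.
by apply: inj_card_eq => x y _ _; exact: finj.
Qed.

Lemma has_decompositionPn (G : sgraph) k (K : Type) : infinite_set [set: K] ->
  [set: K] #<= [set: G] -> ~ has_decomposition G k K ->
  exists X : set G, X #= [set: K] /\ k_connected k X.
Proof.
move=> infK KG nK; apply: contrapT => noX; apply: nK.
(* For [k] equal to 0 every set is [k]-connected, with the empty family of paths, so any subset of
   size [K] serves. *)
have k0 : 0 < k.
  rewrite lt0n; apply/eqP => k0; apply: noX.
  have [|X _ XK] := @card_eq_subset _ K [set: G] _ KG.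
    by apply/infinite_setN0 => /(card_le_finite KG).
  exists X; split=> //; rewrite k0; split; first by rewrite II0; exact: card_ge0.
  move=> Z1 Z2 _ _ _; rewrite II0 => /card_le0P->.
  by exists set0; split=> //; exact: card_eqxx.
apply: decomposition_exists => // S; apply: separating_bag_exists => // X iX KX.
have X0 : X !=set0 by apply/infinite_setN0 => /(card_le_finite KX).
have [Y YX YK] := card_eq_subset X0 KX.
apply: noX; exists Y; split=> //; apply: inseparable_k_connected.
  by have /card_eqPle[_ KY] := YK; move=> /(card_le_finite KY).
exact: inseparable_sub iX.
Qed.

Theorem theorem1 (G : sgraph) (k : nat) (K : Type)
    (infG : infinite_set [set: G])
    (infK : infinite_set [set: K])
    (leKG : [set: K] #<= [set: G]) :
  (exists X : set G, X #= [set: K] /\ k_connected k X) <->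
  (exists L : Type, is_k_tree_width G k L /\ card_lt [set: K] [set: L]).
Proof.
rewrite -k_tree_width_gt; split=> [[X [XK kX]]|]; last exact: has_decompositionPn.
exact: k_connected_no_decomposition XK kX.
Qed.
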